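(* Let $\gamma>1$, $\alpha>0$, $\bar\rho\ge0$, and let $(\rho,u)$ be a global weak solution of (NS) (i.e. a weak solution on $\mathbb R\times(0,T)$ for every $T>0$) which satisfies, with one constant $C$ independent of $T$, the conclusions (1)–(4) of Theorem 2.1 (in the case $0<\alpha\le\frac12$) or the conclusions (1)–(3) of Theorem 2.2 (in the case $\alpha>\frac12$, $\bar\rho>0$). Namely: $\rho\ge0$ is continuous; $\max\rho\le C$ and $\sup_t\int_{\mathbb R}|\rho-\bar\rho|^2dx\le C$ if $\bar\rho>0$ (resp. $\sup_t\int_{\mathbb R}\rho\,dx\le C$ if $\bar\rho=0$); and for all $T>0$, $\sup_{t\in[0,T]}\int_{\mathbb R}\big(|\sqrt\rho u|^2+D(\rho)^2+\rho\Psi(\rho,\bar\rho)\big)dx+\int_0^T\!\int_{\mathbb R}[(\rho^{\frac{\gamma+\alpha-1}{2}})_x]^2dxdt\le C$, where $D(\rho)=(\rho^{\alpha-1/2})_x$ if $\alpha\ne\frac12$ and $D(\rho)=(\log\rho)_x$ if $\alpha=\frac12$. Then $$\lim_{t\to+\infty}\sup_{x\in\mathbb R}|\rho(x,t)-\bar\rho|=0.$$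
   Context: (NS) denotes the one-dimensional isentropic compressible Navier–Stokes Cauchy problem on $\mathbb R\times(0,\infty)$: $\rho_t+(\rho u)_x=0$, $(\rho u)_t+(\rho u^2+P(\rho))_x=(\mu(\rho)u_x)_x$, $(\rho,\rho u)|_{t=0}=(\rho_0,m_0)$, with $P(\rho)=\rho^\gamma$ ($\gamma>1$) and $\mu(\rho)=\rho^\alpha$ ($\alpha>0$). For a constant $\bar\rho\ge0$, $\Psi(\rho,\bar\rho)=\int_{\bar\rho}^{\rho}\frac{P(s)-P(\bar\rho)}{s^2}ds$, so $\rho\Psi(\rho,\bar\rho)=\frac{1}{\gamma-1}[\rho^\gamma-\bar\rho^\gamma-\gamma\bar\rho^{\gamma-1}(\rho-\bar\rho)]$. Weak solution on $\mathbb R\times(0,T)$: a pair $(\rho,u)$ with $\rho\ge0$ a.e., $\rho-\bar\rho\in L^\infty(0,T;L^\infty(\mathbb R))$, $\rho\Psi(\rho,\bar\rho)\in L^\infty(0,T;L^1)$, $\sqrt\rho u\in L^\infty(0,T;L^2)$, $(\rho^{\alpha-1/2})_x\in L^\infty(0,T;L^2)$ if $\alpha\ne\frac12$, $(\log\rho)_x\in L^\infty(0,T;L^2)$ if $\alpha=\frac12$, such that the mass equation holds in the sense $\int\rho\zeta\,dx|_{t_1}^{t_2}=\int_{t_1}^{t_2}\int(\rho\zeta_t+\rho u\zeta_x)dxdt$ for all $\zeta\in C^1$, and the momentum equation holds in the sense $\int m_0\psi(\cdot,0)dx+\int_0^T\int[\sqrt\rho(\sqrt\rho u)\psi_t+((\sqrt\rho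 u)^2+\rho^\gamma)\psi_x]dxdt+\langle\rho^\alpha u_x,\psi_x\rangle=0$ for all $\psi\in C_0^\infty(\mathbb R\times[0,T))$, where $\langle\rho^\alpha u_x,\psi_x\rangle=-\int_0^T\int\rho^{\alpha-1/2}\sqrt\rho u\psi_x-\frac{2\alpha}{2\alpha-1}\int_0^T\int(\rho^{\alpha-1/2})_x\sqrt\rho u\psi$ for $\alpha\ne\frac12$ and $=-\int_0^T\int\sqrt\rho u\psi_x-\frac12\int_0^T\int(\log\rho)_x\sqrt\rho u\psi$ for $\alpha=\frac12$. *)

(* Defs.v *)
From HB Require Import structures.
From mathcomp Require Import all_boot all_order all_algebra.
From mathcomp Require Import all_classical all_reals all_analysis.
Set Implicit Arguments. Unset Strict Implicit. Unset Printing Implicit Defensive.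
Import Order.TTheory GRing.Theory Num.Theory.
Import numFieldNormedType.Exports.
Local Open Scope classical_set_scope.
Local Open Scope ring_scope.

Section NSDefs.
Variable R : realType.
Local Notation lam := (@lebesgue_measure R).

Definition dx (f : R -> R -> R) : R -> R -> R :=
  fun x t => derive1 (fun y => f y t) x.
Definition dt (f : R -> R -> R) : R -> R -> R :=
  fun x t => derive1 (fun s => f x s) t.

Definition C1_2 (f : R -> R -> R) : Prop :=
  [/\ (forall x t, derivable (fun y => f y t) x 1 /\
                   derivable (fun s => f x s) t 1),
      continuous (fun z : R * R => f z.1 z.2),
      continuous (fun z : R * R => dx f z.1 z.2) &
      continuous (fun z : R * R => dt f z.1 z.2)].

Definition itpar (s : seq bool) (f : R -> R -> R) : R -> R -> R :=
  foldr (fun b g => if b then dx g else dt g) f s.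

Definition Cinf_2 (f : R -> R -> R) : Prop := forall s, C1_2 (itpar s f).

Definition testfun1 (phi : R -> R) : Prop :=
  (forall n x, derivable (iter n (@derive1 R R) phi) x 1) /\
  exists K : R, forall x, K < `|x| -> phi x = 0.

Definition epow (p r : R) : \bar R :=
  if (r == 0) && (p < 0) then +oo%E else (powR r p)%:E.
Definition elog (r : R) : \bar R := if r == 0 then -oo%E else (ln r)%:E.

Definition weak_deriv (F : R -> \bar R) (g : R -> R) : Prop :=
  [/\ (forall a b : R, lam.-integrable `[a, b] F),
      (forall a b : R, lam.-integrable `[a, b] (fun x => (g x)%:E)) &
      forall phi, testfun1 phi ->
        (\int[lam]_x (F x * (derive1 phi x)%:E))%E =
        (- \int[lam]_x ((g x * phi x)%:E))%E].

Definition Dfun (alpha r : R) : \bar R :=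
  if alpha == 2^-1 then elog r else epow (alpha - 2^-1) r.

Definition rhoPsi (gamma rb r : R) : R :=
  (powR r gamma - powR rb gamma
     - gamma * powR rb (gamma - 1) * (r - rb)) / (gamma - 1).

Definition jointly_measurable (f : R -> R -> R) : Prop :=
  measurable_fun setT (fun z : R * R => f z.1 z.2).

Definition LinfLp (p T : R) (f : R -> R -> R) : Prop :=
  jointly_measurable f /\
  exists M : R, {ae lam, forall t, 0 < t < T ->
     (\int[lam]_x ((`|f x t| `^ p)%:E) <= M%:E)%E}.

Definition LinfLinf (T : R) (f : R -> R -> R) : Prop :=
  jointly_measurable f /\
  exists M : R, {ae lam, forall t, 0 < t < T ->
     {ae lam, forall x, `|f x t| <= M}}.

Definition weak_solution (gamma alpha rb T : R) (m0 : R -> R)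
    (rho u Dr : R -> R -> R) : Prop :=
  let sru := fun x t => Num.sqrt (rho x t) * u x t in
  (forall x t, 0 <= rho x t) /\
  LinfLinf T (fun x t => rho x t - rb) /\
  LinfLp 1 T (fun x t => rhoPsi gamma rb (rho x t)) /\
  LinfLp 2 T sru /\
  jointly_measurable u /\
  [/\
      {ae lam, forall t, 0 < t < T ->
         weak_deriv (fun x => Dfun alpha (rho x t)) (fun x => Dr x t)},
      LinfLp 2 T Dr,
      (forall zeta t1 t2, C1_2 zeta ->
         (exists K : R, forall x t, K < `|x| -> zeta x t = 0) ->
         0 <= t1 -> t1 <= t2 -> t2 <= T ->
         \int[lam]_x (rho x t2 * zeta x t2) - \int[lam]_x (rho x t1 * zeta x t1)
         = \int[lam]_(t in `[t1, t2]) \int[lam]_x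
              (rho x t * dt zeta x t + rho x t * u x t * dx zeta x t)) &
      (forall psi, Cinf_2 psi ->
         (exists K delta : R, 0 < delta /\ forall x t,
             K < `|x| \/ t < - K \/ T - delta < t -> psi x t = 0) ->
         \int[lam]_x (m0 x * psi x 0)
         + \int[lam]_(t in `]0, T[) \int[lam]_x
             (Num.sqrt (rho x t) * sru x t * dt psi x t
              + (sru x t ^+ 2 + powR (rho x t) gamma) * dx psi x t)
         + (if alpha == 2^-1 then
              - \int[lam]_(t in `]0, T[) \int[lam]_x (sru x t * dx psi x t)
              - 2^-1 * \int[lam]_(t in `]0, T[) \int[lam]_x
                         (Dr x t * sru x t * psi x t)
            else
              - \int[lam]_(t in `]0, T[) \int[lam]_x
                  (powR (rho x t) (alpha - 2^-1) * sru x t * dx psi x t)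
              - (2 * alpha) / (2 * alpha - 1) *
                  \int[lam]_(t in `]0, T[) \int[lam]_x
                    (Dr x t * sru x t * psi x t))
         = 0)].

Definition global_weak_solution (gamma alpha rb : R) (m0 : R -> R)
    (rho u Dr : R -> R -> R) : Prop :=
  forall T, 0 < T -> weak_solution gamma alpha rb T m0 rho u Dr.

End NSDefs.

(* Main.v *)
Require Import Defs.
From HB Require Import structures.
From mathcomp Require Import all_boot all_order all_algebra.
From mathcomp Require Import all_classical all_reals all_analysis.
From mathcomp Require Import measurable_realfun ring lra.
Import Order.TTheory GRing.Theory Num.Theory.
Import numFieldNormedType.Exports.
Local Open Scope classical_set_scope.
Local Open Scope ring_scope.
Set Implicit Arguments.
Unset Strict Implicit.
Unset Printing Implicit Defensive.

(** The [L^2] bound on the derivative of [rho^(alpha - 1/2)] (or [ln rho]) makes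
    [rho(., t)] equicontinuous in [x], uniformly in [t]. By the mass equation the
    local averages of [rho] are Lipschitz in time, uniformly in space, because the
    flux [rho u] is bounded in [L^2]. Hence if [|rho(x, t) - rb| > e], then
    throughout a time interval of fixed length after [t] the density deviates
    somewhere from [rb] by a fixed fraction of [e]. At such a time
    [rho^((gamma + alpha - 1)/2)] varies by a fixed amount over a fixed distance
    (the integral bound on [rho - rb] forces [rho] to be close to [rb] nearby), so
    its derivative has [L^2] norm bounded below. Infinitely many such intervals
    would contradict the finiteness of the total dissipation. *)

(** * Integrals of possibly non-measurable functions *)

(** Three obstacles shape the estimates. At vacuum, a negative power or the logarithm of the density
    is infinite, so these functions take extended real values and the oscillation estimate is
    applied only at points where they are finite; such points are dense. The energy and derivative
    bounds hold only for almost every time, whereas the conclusion concerns all large times;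
    continuity of [rho] in time bridges the gap. Finally, the dissipation is not assumed to be a
    measurable function of time, so integrals are bounded by comparison.

    A single oscillation estimate, [|F y - F x| <= l * K + (y - x) / l] for every [l > 0], serves
    twice. With [K] the energy bound it gives the modulus of continuity; read contrapositively, it
    bounds the dissipation from below. The free parameter [l] stands in for the Cauchy-Schwarz
    inequality. *)

Section IntegralBounds.
Context {d : measure_display} {T : measurableType d} {R : realType}.
Variable mu : {measure set T -> \bar R}.
Local Open Scope ereal_scope.

(* Unlike [ge0_le_integral], no measurability: the integral of a nonnegative
   function is a supremum over the simple functions below it. *)
Lemma le_integral_nonmeasurable (D : set T) (f g : T -> \bar R) :
  (forall x, D x -> 0 <= f x) -> (forall x, D x -> f x <= g x) ->
  \int[mu]_(x in D) f x <= \int[mu]_(x in D) g x.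
Proof.
move=> f0 fg; rewrite !ge0_integralE//; last first.
  by move=> x Dx; exact: le_trans (f0 x Dx) (fg x Dx).
apply: ereal_sup_le => _ [h hf <-]; exists h => // x.
by apply: le_trans (hf x) _; exact: lee_restrict.
Qed.

(** Positive and negative parts of [f] both lie below [g], so both of their integrals lie between 0
    and the integral of [g], and so does the absolute value of their difference. Additivity of the
    integral is avoided, since it would require measurability. *)
Lemma abse_integral_le (D : set T) (f g : T -> \bar R) :
  (forall x, D x -> `|f x| <= g x) ->
  `|\int[mu]_(x in D) f x| <= \int[mu]_(x in D) g x.
Proof.
move=> fg; rewrite integralE.
have p0 : 0 <= \int[mu]_(x in D) f^\+ x by exact: integral_ge0.
have n0 : 0 <= \int[mu]_(x in D) f^\- x by exact: integral_ge0.
have pg : \int[mu]_(x in D) f^\+ x <= \int[mu]_(x in D) g x.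
  apply: le_integral_nonmeasurable => // x Dx; apply: le_trans (fg x Dx).
  by rewrite funeposE ge_max abse_ge0 lee_abs.
have ng : \int[mu]_(x in D) f^\- x <= \int[mu]_(x in D) g x.
  apply: le_integral_nonmeasurable => // x Dx; apply: le_trans (fg x Dx).
  by rewrite funenegE ge_max abse_ge0 -abseN lee_abs.
case: (\int[mu]_(x in D) g x) pg ng => [r| |] pg ng;
  [|by rewrite leey|by move: (le_trans p0 pg)].
move: p0 n0 pg ng.
case: (\int[mu]_(x in D) f^\+ x) => [p| |]//.
case: (\int[mu]_(x in D) f^\- x) => [n| |]//.
rewrite !lee_fin => p0 n0 pr nr; rewrite ler_norml.
by apply/andP; split; lra.
Qed.

Lemma abse_integral_ae_le_cst (D : set T) (f : T -> \bar R) (c : R) :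
  measurable D -> (0 <= c)%R ->
  {ae mu, forall x, D x -> `|f x| <= c%:E} ->
  `|\int[mu]_(x in D) f x| <= c%:E * mu D.
Proof.
move=> mD c0 [N [mN N0 subN]].
(* Infinity on the null set makes the bound hold everywhere, and [g], unlike [f], is measurable, so
   its integral can be computed. *)
pose g : T -> \bar R := fun x => if x \in N then +oo else c%:E.
have fg x : D x -> `|f x| <= g x.
  move=> Dx; rewrite /g; case: ifPn => [_|]; first by rewrite leey.
  rewrite notin_setE => nNx; apply: contrapT => nf.
  by apply: nNx; apply: subN => /= /(_ Dx).
apply: le_trans (abse_integral_le fg) _.
have mg : measurable_fun D g.
  apply: measurable_fun_if => //; apply: (@measurable_fun_bool _ _ _ _ true).
  rewrite (_ : D `&` _ = D `&` N); first exact: measurableI.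
  by apply/seteqP; split => x [Dx Nx]; split => //; [exact: set_mem|exact: mem_set].
rewrite (@ae_eq_integral _ _ _ mu D (cst c%:E))//.
  by rewrite integral_cst.
exists N; split => // x /= /not_implyP[Dx].
by rewrite /g; case: ifPn; rewrite ?inE.
Qed.

Lemma ae_imply (P Q : T -> Prop) :
  (forall x, P x -> Q x) -> {ae mu, forall x, P x} -> {ae mu, forall x, Q x}.
Proof. by move=> PQ [N [mN N0 sub]]; exists N; split => // x nQ; apply: sub => /PQ. Qed.

Lemma ae_imply2 (P Q S : T -> Prop) : (forall x, P x -> Q x -> S x) ->
  {ae mu, forall x, P x} -> {ae mu, forall x, Q x} -> {ae mu, forall x, S x}.
Proof.
by move=> PQS; apply: (@filterS2 _ _ (ae_filter_ringOfSetsType mu)) => x /PQS; exact.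
Qed.

End IntegralBounds.

Lemma ae_dense (R : realType) (P : R -> Prop) (a b : R) :
  {ae @lebesgue_measure R, forall x, a < x < b -> P x} -> a < b ->
  exists x, a < x < b /\ P x.
Proof.
move=> [N [mN N0 subN]] ab; apply: contrapT => nP.
have sub : `]a, b[%classic `<=` N.
  move=> x /=; rewrite in_itv/= => xab; apply: subN => /= /(_ xab) Px.
  by apply: nP; exists x.
have : (lebesgue_measure `]a, b[%classic <= lebesgue_measure N)%E.
  by apply: le_measure => //; rewrite inE.
rewrite lebesgue_measure_itv/= lte_fin ab N0 -EFinB lee_fin; lra.
Qed.

(** The exceptional set may depend on [T]; only the countably many horizons [n.+1] are used, so the
    union stays null. *)
Lemma ae_pos (R : realType) (P : R -> Prop) :
  (forall T, 0 < T -> {ae @lebesgue_measure R, forall t, 0 < t < T -> P t}) ->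
  {ae @lebesgue_measure R, forall t, 0 < t -> P t}.
Proof.
move=> aeP.
have aen : {ae @lebesgue_measure R, forall t (n : nat), 0 < t < n.+1%:R -> P t}.
  by apply: ae_foralln => n; apply: aeP; rewrite ltr0n.
apply: ae_imply aen => t Pt t0.
apply: (Pt (Num.truncn t)); rewrite t0/=.
by case/andP: (truncn_itv (ltW t0)).
Qed.

(** * A smooth step function *)

Section Smooth.
Context {R : realType}.
Implicit Types (f g : R -> R) (x : R).

Definition smooth f := forall n x, derivable (iter n (@derive1 R R) f) x 1.

Lemma is_derive_derive1 f f' :
  (forall x, is_derive x 1 f (f' x)) -> derive1 f = f'.
Proof. by move=> df; apply/funext => x; rewrite derive1E; exact: derive_val. Qed.

(** A class of functions stable under derivation consists of smooth functions. Exhibiting such a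
    class replaces explicit formulas for higher derivatives. *)
Lemma smooth_coind (P : (R -> R) -> Prop) :
  (forall f, P f -> exists2 f', P f' & forall x, is_derive x 1 f (f' x)) ->
  forall f, P f -> smooth f.
Proof.
move=> Pstep f Pf n; elim: n f Pf => [|n IH] f /Pstep[f' Pf' df] x.
  exact: ex_derive.
by rewrite iterSr (is_derive_derive1 df); exact: IH.
Qed.

Lemma smooth_derive1 f : smooth f -> smooth (derive1 f).
Proof. by move=> sf n x; rewrite -iterSr; exact: (sf n.+1 x). Qed.

Lemma smooth_is_derive f x : smooth f -> is_derive x 1 f (derive1 f x).
Proof. by move=> sf; rewrite derive1E; apply: derivableP; exact: (sf 0%N x). Qed.

Lemma smooth_continuous f : smooth f -> continuous f.
Proof.
move=> sf x; apply: differentiable_continuous; apply/derivable1_diffP.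
exact: (sf 0%N x).
Qed.

Lemma smooth_cst (c : R) : smooth (fun=> c).
Proof.
apply: (@smooth_coind (fun f => exists c, f = fun=> c)); last by exists c.
by move=> _ [a ->]; exists (fun=> 0); [exists 0|move=> x; exact: is_derive_cst].
Qed.

Lemma smoothD f g : smooth f -> smooth g -> smooth (fun x => f x + g x).
Proof.
move=> sf sg; apply: (@smooth_coind (fun h => exists f g,
  [/\ smooth f, smooth g & h = fun x => f x + g x])); last by exists f, g.
move=> _ [{sf}f [{sg}g [sf sg ->]]].
exists (fun x => derive1 f x + derive1 g x).
  by exists (derive1 f), (derive1 g); split => //; exact: smooth_derive1.
by move=> x; apply: is_deriveD; exact: smooth_is_derive.
Qed.

(** Products alone are not stable under derivation, but by the Leibniz rule their finite sums
    are. *)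
Inductive sum_of_products : (R -> R) -> Prop :=
| SumProd1 f g : smooth f -> smooth g -> sum_of_products (fun x => f x * g x)
| SumProdD f g : sum_of_products f -> sum_of_products g ->
    sum_of_products (fun x => f x + g x).

Lemma smoothM f g : smooth f -> smooth g -> smooth (fun x => f x * g x).
Proof.
move=> sf sg; apply: (@smooth_coind sum_of_products); last exact: SumProd1.
move=> h; elim => {sf sg h} [{}f {}g sf sg|{}f {}g _ [f' Pf' df] _ [g' Pg' dg]].
  exists (fun x => f x * derive1 g x + g x * derive1 f x).
    by apply: SumProdD; apply: SumProd1 => //; exact: smooth_derive1.
  by move=> x; apply: is_deriveM; exact: smooth_is_derive.
exists (fun x => f' x + g' x); first exact: SumProdD.
by move=> x; exact: is_deriveD.
Qed.

Lemma smooth_affine f (a b : R) : smooth f -> smooth (fun x => f (a * x + b)).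
Proof.
move=> sf; apply: (@smooth_coind (fun h => exists c g,
  smooth g /\ h = fun x => c * g (a * x + b))); last first.
  by exists 1, f; split => //; apply/funext => x; rewrite mul1r.
move=> _ [c [{sf}g [sg ->]]].
exists (fun x => (c * a) * derive1 g (a * x + b)).
  by exists (c * a), (derive1 g); split => //; exact: smooth_derive1.
move=> x; have dl : is_derive x 1 (fun y => a * y + b) a.
  have := @is_deriveD _ _ _ (cst a * id) (cst b) x 1 _ _
    (@is_deriveM _ _ (cst a) id x 1 _ _ (is_derive_cst a x 1) (is_derive_id x 1))
    (is_derive_cst b x 1).
  by move=> dh; apply: (is_derive_eq dh); rewrite /= scaler0 !addr0 /GRing.scale/= mulr1.
have dg := @is_derive1_comp _ g (fun y => a * y + b) x _ _ (smooth_is_derive _ sg) dl.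
have := @is_deriveM _ _ (cst c) _ x 1 _ _ (is_derive_cst c x 1) dg.
by move=> dh; apply: (is_derive_eq dh); rewrite /= scaler0 addr0 /GRing.scale/=; ring.
Qed.

Lemma smooth_quotient f g : smooth f -> smooth g -> (forall x, g x != 0) ->
  smooth (fun x => f x / g x).
Proof.
move=> sf sg g0; apply: (@smooth_coind (fun h => exists p n,
  smooth p /\ h = fun x => p x * (g x)^-1 ^+ n)); last by exists f, 1%N.
move=> _ [p [n [sp ->]]].
exists (fun x => (derive1 p x * g x + (- n%:R * (p x * derive1 g x))) * (g x)^-1 ^+ n.+1).
  exists (fun x => derive1 p x * g x + (- n%:R * (p x * derive1 g x))), n.+1.
  split=> //; apply: smoothD; apply: smoothM => //.
  - exact: smooth_derive1.
  - exact: smooth_cst.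
  - by apply: smoothM => //; exact: smooth_derive1.
move=> x.
have dV := is_deriveV (g0 x) (smooth_is_derive x sg).
have := @is_deriveX _ _ _ n _ _ _ dV; rewrite exprfctE => dX.
have := @is_deriveM _ _ _ _ x 1 _ _ (smooth_is_derive x sp) dX.
move=> dh; apply: (is_derive_eq dh); rewrite /GRing.scale/=.
case: n {dX dh} => [|n]/=; first by rewrite !expr0 expr1; field.
by rewrite !exprS; field.
Qed.

(* [x^-n exp (-1/x)] extended by zero: a family whose span is stable under
   derivation. *)
Definition flat (n : nat) x := if 0 < x then x^-1 ^+ n * expR (- x^-1) else 0.

(** Serves at the gluing point of [flat]: the difference quotient at 0 is at most [K * |h|]. *)
Lemma is_derive0_quadratic f (K : R) :
  (forall x, `|f x| <= K * x ^+ 2) -> is_derive (0 : R) 1 f 0.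
Proof.
move=> fK.
have f0 : f 0 = 0.
  by apply/eqP; rewrite -normr_le0; have := fK 0; rewrite expr0n/= mulr0.
have K0 : 0 <= K by have := le_trans (normr_ge0 _) (fK 1); rewrite expr1n mulr1.
have cv : (fun h : R => h^-1 *: ((f \o shift 0) (h *: 1) - f 0)) @ 0^' --> (0 : R).
  apply/cvgr0Pnorm_le => e e0; near=> h.
  have hn0 : h != 0 by near: h; exact: nbhs_dnbhs_neq.
  rewrite /= f0 subr0 addr0 /GRing.scale/= mulr1 normrM normfV.
  rewrite ler_pdivrMl ?normr_gt0//.
  apply: le_trans (fK h) _; rewrite -real_normK ?num_real// expr2 mulrA mulrC.
  rewrite ler_pM2l ?normr_gt0//.
  apply: (@le_trans _ _ ((K + 1) * `|h|)); first by rewrite ler_wpM2r// lerDl.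
  rewrite -ler_pdivlMl; last by rewrite ltr_wpDl.
  near: h; apply: dnbhs0_le; rewrite mulr_gt0// invr_gt0 ltr_wpDl//.
split; first by apply/cvg_ex; exists 0.
exact: cvg_lim.
Unshelve. all: by end_near. Qed.

(** With [y = 1/x], the exponential series gives [exp y >= y^(n+2) / (n+2)!], hence
    [y^n exp (-y) <= (n+2)! / y^2]. *)
Lemma flat_bound n x : `|flat n x| <= (n.+2)`!%:R * x ^+ 2.
Proof.
rewrite /flat; case: ifPn => [x0|_]; last first.
  by rewrite normr0 mulr_ge0// sqr_ge0.
have y0 : 0 < x^-1 by rewrite invr_gt0.
rewrite ger0_norm; last by rewrite mulr_ge0 ?expR_ge0// exprn_ge0// ltW.
have := expR_ge1Dxn n.+1 (ltW y0).
rewrite expRN ler_pdivrMr ?expR_gt0// => h.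
have F0 : 0 < (n.+2)`!%:R :> R by rewrite ltr0n fact_gt0.
have {}h : x^-1 ^+ n.+2 / n.+2`!%:R <= expR x^-1 by apply: le_trans h; rewrite lerDr.
rewrite ler_pdivrMr// in h.
rewrite -mulrA mulrC -mulrA -ler_pdivrMl ?exprn_gt0//.
apply: le_trans h; rewrite le_eqVlt; apply/orP; left; apply/eqP.
by rewrite !exprS expr0; field; rewrite gt_eqF.
Qed.

Lemma is_derive_flat n x :
  is_derive x 1 (flat n) (- n%:R * flat n.+1 x + flat n.+2 x).
Proof.
have [x0|x0|->] := ltgtP x 0; last first.
- rewrite /flat ltxx mulr0 addr0; exact: is_derive0_quadratic (flat_bound n).
- rewrite {2 3}/flat x0.
  have xn0 : x != 0 by rewrite gt_eqF.
  have dV := is_deriveV xn0 (is_derive_id x 1).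
  have := @is_deriveX _ _ _ n _ _ _ dV; rewrite exprfctE => dX.
  have dE := @is_derive1_comp _ expR (- (fun y : R => y^-1)) x _ _
    (is_derive_expR _) (is_deriveN dV).
  have dM := @is_deriveM _ _ _ _ x 1 _ _ dX dE.
  apply: (@near_eq_is_derive _ _ _
    ((fun y => y^-1 ^+ n) * (expR \o - (fun y : R => y^-1)))).
    near=> y; rewrite /flat ifT; last by near: y; exact: lt_nbhsr.
    by [].
  apply: (is_derive_eq dM); rewrite /GRing.scale/=.
  case: n {dX dM} => [|n]/=; first by rewrite !exprS !expr0; field.
  by rewrite !exprS; field.
- rewrite /flat !ifF; [|exact: lt_gtF..].
  rewrite mulr0 addr0; apply: near_eq_is_derive (is_derive_cst (0 : R) x 1).
  by near=> y; rewrite ifF//; apply: lt_gtF; near: y; exact: lt_nbhsl.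
Unshelve. all: by end_near. Qed.

Inductive flat_span : (R -> R) -> Prop :=
| FlatSpan1 n : flat_span (flat n)
| FlatSpanL (c : R) f g : flat_span f -> flat_span g ->
    flat_span (fun x => c * f x + g x).

Lemma smooth_flat n : smooth (flat n).
Proof.
apply: (@smooth_coind flat_span); last exact: FlatSpan1.
move=> h; elim => {h n} [n|c f g _ [f' Pf' df] _ [g' Pg' dg]].
  exists (fun x => - n%:R * flat n.+1 x + flat n.+2 x); last exact: is_derive_flat.
  by apply: FlatSpanL; exact: FlatSpan1.
exists (fun x => c * f' x + g' x); first exact: FlatSpanL.
by move=> x; apply: is_deriveD.
Qed.

Definition step x := flat 0 x / (flat 0 x + flat 0 (1 - x)).

Lemma flat0_ge0 x : 0 <= flat 0 x.
Proof. by rewrite /flat; case: ifP => // _; rewrite expr0 mul1r expR_ge0. Qed.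

Lemma flat0_gt0 x : 0 < x -> 0 < flat 0 x.
Proof. by rewrite /flat => ->; rewrite expr0 mul1r expR_gt0. Qed.

Lemma step_den_gt0 x : 0 < flat 0 x + flat 0 (1 - x).
Proof.
have [x0|x0] := ltP 0 x; first by rewrite ltr_pwDl ?flat0_gt0 ?flat0_ge0.
by rewrite ltr_wpDl ?flat0_ge0// flat0_gt0// subr_gt0 (le_lt_trans x0).
Qed.

Lemma smooth_step : smooth step.
Proof.
have s1 : smooth (fun x => flat 0 (1 - x)).
  rewrite (_ : (fun _ => _) = fun x => flat 0 (-1 * x + 1)).
    exact/smooth_affine/smooth_flat.
  by apply/funext => x; congr flat; ring.
have s0 := @smooth_flat 0.
have s2 := smoothD s0 s1.
have n0 x : flat 0 x + flat 0 (1 - x) != 0 by rewrite gt_eqF// step_den_gt0.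
refine (smooth_quotient s0 s2 n0).
Qed.

Lemma step_le0 x : x <= 0 -> step x = 0.
Proof. by move=> x0; rewrite /step {1}/flat ltNge x0 mul0r. Qed.

Lemma step_ge1 x : 1 <= x -> step x = 1.
Proof.
move=> x1; rewrite /step {3}/flat subr_gt0 ltNge x1 addr0 divff//.
by rewrite gt_eqF// flat0_gt0// (lt_le_trans _ x1).
Qed.

Lemma step_itv x : 0 <= step x <= 1.
Proof.
have d0 := step_den_gt0 x.
rewrite /step divr_ge0 ?flat0_ge0 ?(ltW d0)//=.
by rewrite ler_pdivrMr ?step_den_gt0// mul1r lerDl flat0_ge0.
Qed.

Lemma derive1_loc_cst f x (c : R) : (\near x, f x = c) -> derive1 f x = 0.
Proof.
move=> fc; rewrite derive1E.
by rewrite (@near_eq_derive _ _ _ _ (cst c))// derive_cst.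
Qed.

Lemma derive1_step0 x : x < 0 \/ 1 < x -> derive1 step x = 0.
Proof.
case=> h; [apply: (@derive1_loc_cst _ _ 0)|apply: (@derive1_loc_cst _ _ 1)]; near=> y.
- by apply: step_le0; apply: ltW; near: y; exact: lt_nbhsl.
- by apply: step_ge1; apply: ltW; near: y; exact: lt_nbhsr.
Unshelve. all: by end_near. Qed.

Lemma derive2_step0 x : x < 0 \/ 1 < x -> derive1 (derive1 step) x = 0.
Proof.
case=> h; apply: (@derive1_loc_cst _ _ 0); near=> y; apply: derive1_step0.
- by left; near: y; exact: lt_nbhsl.
- by right; near: y; exact: lt_nbhsr.
Unshelve. all: by end_near. Qed.

Lemma compact_support_bounded f : continuous f ->
  (forall x, x < 0 \/ 1 < x -> f x = 0) -> exists2 M, 0 < M & forall x, `|f x| <= M.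
Proof.
move=> cf f0.
have cn : {within `[0, 1], continuous (fun x => `|f x|)}.
  apply: continuous_subspaceT => x.
  by apply: continuous_comp; [exact: cf|exact: norm_continuous].
have [c _ cmax] := EVT_max ler01 cn.
exists (`|f c| + 1) => [|x]; first by rewrite ltr_wpDl.
have [x01|] := boolP (x \in `[0, 1]); first by rewrite (le_trans (cmax _ x01))// lerDl.
rewrite in_itv/= negb_and -!ltNge => /orP h.
by rewrite f0// normr0 addr_ge0.
Qed.

End Smooth.

(** * Mollifiers *)

Section Kernel.
Context {R : realType}.
Implicit Types (x h z : R).
Local Notation lam := (@lebesgue_measure R).

(** A smoothed Heaviside step whose derivative [kernel] is a one-sided mollifier on [[x, x + h]].
    Introducing the mollifier as a derivative gives its unit mass by the fundamental theorem of
    calculus, and makes a difference of two mollifiers the derivative of a compactly supported test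
    function. *)
Definition ramp x h z : R := step (h^-1 * z + (- x / h)).
Definition kernel x h : R -> R := derive1 (ramp x h).

Lemma smooth_ramp x h : smooth (ramp x h).
Proof. exact: smooth_affine (@smooth_step R). Qed.

Lemma smooth_kernel x h : smooth (kernel x h).
Proof. exact/smooth_derive1/smooth_ramp. Qed.

Lemma derive1_affine (f : R -> R) (a b z : R) : smooth f ->
  derive1 (fun y => f (a * y + b)) z = a * derive1 f (a * z + b).
Proof.
move=> sf.
have da : derivable (fun y : R => a * y + b) z 1.
  by apply: (@derivableD _ _ _ (cst a * id) (cst b)).
have -> : (fun y => f (a * y + b)) = f \o (fun y => a * y + b) by [].
rewrite derive1_comp//; last exact: (sf 0%N _).
rewrite mulrC; congr (_ * _); rewrite derive1E.
have := @is_deriveD _ _ _ (cst a * id) (cst b) z 1 _ _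
    (@is_deriveM _ _ (cst a) id z 1 _ _ (is_derive_cst a z 1) (is_derive_id z 1))
    (is_derive_cst b z 1).
by move=> dh; rewrite (@derive_val _ _ _ _ _ _ _ dh) /= scaler0 !addr0 /GRing.scale/= mulr1.
Qed.

Lemma kernelE x h z : kernel x h z = h^-1 * derive1 step (h^-1 * z + (- x / h)).
Proof. by rewrite /kernel /ramp derive1_affine//; exact: smooth_step. Qed.

Lemma derive1_kernelE x h z :
  derive1 (kernel x h) z = h^-1 * (h^-1 * derive1 (derive1 step) (h^-1 * z + (- x / h))).
Proof.
rewrite (_ : kernel x h = fun y =>
    (fun w => h^-1 * derive1 step w) (h^-1 * y + (- x / h))); last first.
  by apply/funext => y; rewrite kernelE.
rewrite (@derive1_affine (fun w => h^-1 * derive1 step w)); last first.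
  by apply: smoothM; [exact: smooth_cst|exact/smooth_derive1/smooth_step].
congr (_ * _); rewrite derive1E.
have := @is_deriveM _ _ (cst h^-1) (derive1 step) (h^-1 * z + - x / h) 1 _ _
  (is_derive_cst _ _ _) (smooth_is_derive _ (smooth_derive1 (@smooth_step R))).
by move=> dh; rewrite (@derive_val _ _ _ _ _ _ _ dh) /= scaler0 addr0.
Qed.

Section PositiveWidth.
Variables (x h : R).
Hypothesis h0 : 0 < h.

Let rescale z : h^-1 * z + (- x / h) = (z - x) / h.
Proof. by field; rewrite gt_eqF. Qed.

Lemma ramp_le z : z <= x -> ramp x h z = 0.
Proof.
by move=> zx; rewrite /ramp rescale step_le0// pmulr_lle0 ?invr_gt0// subr_le0.
Qed.

Lemma ramp_ge z : x + h <= z -> ramp x h z = 1.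
Proof.
by move=> zx; rewrite /ramp rescale step_ge1// ler_pdivlMr// mul1r lerBrDl.
Qed.

Lemma ramp_itv z : 0 <= ramp x h z <= 1.
Proof. exact: step_itv. Qed.

Let outside z : ~ `[x, x + h]%classic z -> (z - x) / h < 0 \/ 1 < (z - x) / h.
Proof.
move=> /negP; rewrite in_itv/= negb_and -!ltNge => /orP[zx|zx]; [left|right].
  by rewrite pmulr_llt0 ?invr_gt0// subr_lt0.
by rewrite ltr_pdivlMr// mul1r ltrBrDl.
Qed.

Lemma kernel_out z : ~ `[x, x + h]%classic z -> kernel x h z = 0.
Proof. by move=> /outside zx; rewrite kernelE rescale derive1_step0 ?mulr0. Qed.

Lemma derive1_kernel_out z :
  ~ `[x, x + h]%classic z -> derive1 (kernel x h) z = 0.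
Proof.
by move=> /outside zx; rewrite derive1_kernelE rescale derive2_step0 ?mulr0.
Qed.

Lemma kernel_continuous : continuous (kernel x h).
Proof. exact/smooth_continuous/smooth_kernel. Qed.

Lemma integral_kernel : (\int[lam]_(z in `[x, (x + h)%R]) (kernel x h z)%:E = 1)%E.
Proof.
have xh : x < x + h by rewrite ltrDl.
have cr : continuous (ramp x h) by exact/smooth_continuous/smooth_ramp.
rewrite (@continuous_FTC2 _ _ (ramp x h))//.
- by rewrite ramp_ge// ramp_le// sube0.
- by apply: continuous_subspaceT => z; exact: kernel_continuous.
- split.
  + by move=> z _; exact: (@smooth_ramp x h 0%N z).
  + exact/cvg_at_right_filter/cr.
  + exact/cvg_at_left_filter/cr.
Qed.

Variable M : R.
Hypothesis kM : forall z, `|kernel x h z| <= M / h.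

(** By unit mass, [c] is itself an average against the kernel. The kernel is controlled by [M / h]
    in absolute value over a length [h], hence the factor [M] in the error. Closeness to [c] makes
    [F] finite on the support. *)
Lemma kernel_mean (F : R -> \bar R) (c e : R) :
  lam.-integrable `[x, x + h] F ->
  (forall z, `[x, x + h]%classic z -> (`|F z - c%:E| <= e%:E)%E) ->
  lam.-integrable setT (fun z => F z * (kernel x h z)%:E)%E /\
  (`|\int[lam]_z (F z * (kernel x h z)%:E) - c%:E| <= (e * M)%:E)%E.
Proof.
move=> iF Fc; set D := `[x, x + h]%classic.
have mD : @measurable _ (measurableTypeR R) D by exact: measurable_itv.
have muD : (lam D = h%:E)%E.
  by rewrite /D lebesgue_measure_itv/= lte_fin ltrDl h0 -EFinD addrC addKr.
have FkD : (fun z => F z * (kernel x h z)%:E)%E \_ D =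
    (fun z => F z * (kernel x h z)%:E)%E.
  apply/funext => z; rewrite patchE; case: ifPn => //; rewrite notin_setE => Dz.
  by rewrite kernel_out// mule0.
have mk : @measurable_fun _ _ (measurableTypeR R) R D (kernel x h).
  apply: measurable_funTS; apply: continuous_measurable_fun; exact: kernel_continuous.
have ik : lam.-integrable D (EFin \o kernel x h).
  apply: continuous_compact_integrable; first exact: segment_compact.
  by apply: continuous_subspaceT => z; exact: kernel_continuous.
have bk : [bounded kernel x h z | z in D].
  exists (M / h); split; first exact: num_real.
  by move=> b Mb z _; exact: le_trans (kM z) (ltW Mb).
have iFk : lam.-integrable D (fun z => F z * (kernel x h z)%:E)%E.
  exact: (integrableMl mD iF mk bk).
split; first by move/(integrable_mkcond _ mD): iFk; rewrite FkD.
have -> : (\int[lam]_z (F z * (kernel x h z)%:E) =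
    \int[lam]_(z in D) (F z * (kernel x h z)%:E))%E by rewrite [RHS]integral_mkcond FkD.
have {1}-> : c%:E = (\int[lam]_(z in D) (c%:E * (kernel x h z)%:E))%E.
  by rewrite integralZl// integral_kernel mule1.
have ick : lam.-integrable D (fun z => c%:E * (kernel x h z)%:E)%E.
  exact: integrableZl.
rewrite -integralB//.
apply: (@le_trans _ _ (\int[lam]_(z in D) (cst (e * (M / h))%:E z))%E).
  apply: abse_integral_le => z Dz; have := Fc z Dz.
  case: (F z) => [r| |]//=; rewrite -?EFinM -?EFinB ?abse_EFin ?lee_fin => re.
  by rewrite -mulrBl normrM ler_pM.
have -> : (\int[lam]_(z in D) (cst (e * (M / h))%:E z) = (e * (M / h))%:E * lam D)%E.
  exact: (integral_cst lam mD).
by rewrite muD -EFinM lee_fin -!mulrA mulVf ?mulr1// gt_eqF.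
Qed.

End PositiveWidth.

(** One constant serves all positions [x]; the uniformity in space of the later estimates rests on
    this. *)
Lemma kernel_bounds : exists2 M : R, 0 < M & forall x h z, 0 < h ->
  `|kernel x h z| <= M / h /\ `|derive1 (kernel x h) z| <= M / h ^+ 2.
Proof.
have s1 := smooth_derive1 (@smooth_step R).
have [M1 M10 b1] := compact_support_bounded (smooth_continuous s1) (@derive1_step0 R).
have [M2 M20 b2] := compact_support_bounded (smooth_continuous (smooth_derive1 s1))
  (@derive2_step0 R).
exists (M1 + M2) => [|x h z h0]; first by rewrite addr_gt0.
split; rewrite ?kernelE ?derive1_kernelE !normrM normfV (gtr0_norm h0).
  rewrite mulrC ler_pM2r ?invr_gt0//; apply: le_trans (b1 _) _.
  by rewrite lerDl ltW.
rewrite mulrA mulrC expr2 invfM ler_pM2r ?mulr_gt0 ?invr_gt0//.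
by apply: le_trans (b2 _) _; rewrite lerDr ltW.
Qed.

End Kernel.

(** * Oscillation of functions with a square-integrable weak derivative *)

Section WeakDerivative.
Context {R : realType}.
Local Notation lam := (@lebesgue_measure R).
Implicit Types (F : R -> \bar R) (g : R -> R) (x y : R).

Lemma locally_integrable_measurable F :
  (forall a b : R, lam.-integrable `[a, b] F) ->
  @measurable_fun _ _ (measurableTypeR R) (\bar R) setT F.
Proof.
move=> iF.
have -> : [set: R] = \bigcup_(n : nat) `[- n%:R, n%:R]%classic.
  apply/esym/seteqP; split => // z _; exists (Num.truncn `|z|).+1 => //=.
  by rewrite in_itv/= -ler_norml ltW// truncnS_gt.
apply/(@measurable_fun_bigcup _ _ (measurableTypeR R)) => n.
  exact: measurable_itv.
exact: measurable_int (iF _ _).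
Qed.

(* The bound forces [F] to be finite near [x], so that [fine] returns no junk value. *)
Definition finitely_continuous_at F x :=
  forall e, 0 < e -> exists2 h, 0 < h &
    forall z, `|z - x| <= h -> (`|F z - (fine (F x))%:E| <= e%:E)%E.

Lemma testfun1_ramp x y h : 0 < h -> x <= y ->
  testfun1 (fun z => ramp x h z - ramp y h z).
Proof.
move=> h0 xy; have srx := @smooth_ramp R x h; have sry := @smooth_ramp R y h; split.
  have : smooth (fun z => ramp x h z + (-1) * ramp y h z).
    exact: (smoothD srx (smoothM (@smooth_cst R (-1)) sry)).
  rewrite (_ : (fun z => ramp x h z + (-1) * ramp y h z) =
    (fun z => ramp x h z - ramp y h z)); last first.
    by apply/funext => z; rewrite mulN1r.
  by move=> s n z; exact: s.
exists (`|x| + `|y| + h) => z; rewrite ltNge ler_norml negb_and -!ltNge.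
have := ler_norm x; have := ler_norm y.
have := ler_norm (- x); have := ler_norm (- y); rewrite !normrN => a b c d.
by case/orP => hz; [rewrite !ramp_le ?subrr//|rewrite !ramp_ge ?subrr//]; lra.
Qed.

Lemma derive1_ramp x y h z :
  derive1 (fun z => ramp x h z - ramp y h z) z = kernel x h z - kernel y h z.
Proof.
have dx := smooth_is_derive z (@smooth_ramp R x h).
have dy := smooth_is_derive z (@smooth_ramp R y h).
have dxy := is_deriveB dx dy.
by rewrite derive1E (@derive_val _ _ _ _ _ _ _ dxy).
Qed.

(** Pointwise Young inequality [|g| q <= l g^2 + q^2 / l], where [q] is the size of the ramp
    difference and [q^2] is at most the indicator of [[x, y + h]]. The majorant is a sum of
    nonnegative measurable functions. *)
Lemma integral_ramp_le g (K l x y h : R) :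
  (forall a b : R, lam.-integrable `[a, b] (fun z => (g z)%:E)) ->
  (\int[lam]_z (g z ^+ 2)%:E <= K%:E)%E -> 0 < l -> 0 < h -> x <= y ->
  (`|\int[lam]_z (g z * (ramp x h z - ramp y h z))%:E|
     <= (l * K + (y - x + h) / l)%:E)%E.
Proof.
move=> ig gK l0 h0 xy; set D := `[x, y + h]%classic.
have mD : @measurable _ (measurableTypeR R) D by exact: measurable_itv.
have muD : (lam D = (y - x + h)%:E)%E.
  rewrite /D lebesgue_measure_itv/= lte_fin ltr_pwDr// -EFinD.
  by congr EFin; ring.
have mg : @measurable_fun _ _ (measurableTypeR R) R setT g.
  by apply/measurable_EFinP; exact: locally_integrable_measurable.
pose k z : \bar R := (l%:E * (g z ^+ 2)%:E + (l^-1)%:E * (\1_D z)%:E)%E.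
have -> : ((l * K + (y - x + h) / l)%:E = l%:E * K%:E + (l^-1)%:E * lam D)%E.
  by rewrite muD -!EFinM -EFinD; congr EFin; ring.
apply: (@le_trans _ _ (\int[lam]_z k z)%E).
  apply: abse_integral_le => z _; rewrite /k -!EFinM -EFinD lee_fin normrM.
  set q := `|ramp x h z - ramp y h z|.
  have q1 : q ^+ 2 <= \1_D z.
    rewrite indicE /D mem_setE; have [zD|] := boolP (z \in `[x, y + h]).
      rewrite expr_le1// /q; last exact: normr_ge0.
      have := ramp_itv x h z; have := ramp_itv y h z.
      by rewrite ler_norml => /andP[? ?] /andP[? ?]; apply/andP; split; lra.
    rewrite in_itv/= negb_and -!ltNge /q => /orP hz.
    suff -> : ramp x h z - ramp y h z = 0 by rewrite normr0 expr0n.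
    by case: hz => hz; [rewrite !ramp_le ?subrr//|rewrite !ramp_ge ?subrr//]; lra.
  have il0 : 0 < l^-1 by rewrite invr_gt0.
  apply: (@le_trans _ _ (l * g z ^+ 2 + l^-1 * q ^+ 2)); last first.
    by rewrite lerD2l ler_pM2l.
  rewrite -(real_normK (num_real (g z))).
  (* Completing the square shows the gap in Young's inequality to be nonnegative. *)
  have -> : l * `|g z| ^+ 2 + l^-1 * q ^+ 2 = `|g z| * q + l^-1 *
      ((l * `|g z| - q / 2) ^+ 2 + 3 / 4 * q ^+ 2) by field; rewrite gt_eqF.
  rewrite lerDl mulr_ge0 ?(ltW il0)// addr_ge0 ?sqr_ge0// mulr_ge0 ?sqr_ge0//.
rewrite /k ge0_integralD//; last 4 first.
- by move=> z _; rewrite -EFinM lee_fin mulr_ge0 ?sqr_ge0 ?ltW.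
- apply: (@measurable_funeM _ (measurableTypeR R)).
  by apply/measurable_EFinP; exact: measurable_funX.
- by move=> z _; rewrite -EFinM lee_fin mulr_ge0// ltW// invr_gt0.
- apply: (@measurable_funeM _ (measurableTypeR R)).
  by apply/measurable_EFinP; exact: measurable_indic.
rewrite ge0_integralZl//; last 3 first.
- by apply/measurable_EFinP; exact: measurable_funX.
- by move=> z _; rewrite lee_fin sqr_ge0.
- by rewrite lee_fin ltW.
rewrite ge0_integralZl//; last 2 first.
- by apply/measurable_EFinP; exact: measurable_indic.
- by rewrite lee_fin ltW// invr_gt0.
have -> : (\int[lam]_z (\1_D z)%:E = lam D)%E.
  by have := integral_indic lam measurableT mD; rewrite setIT.
by rewrite leeD2r// lee_pmul2l.
Qed.

Lemma abse_sub_le_fin (I : \bar R) (c e : R) :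
  (`|I - c%:E| <= e%:E)%E -> exists2 a, I = a%:E & `|a - c| <= e.
Proof. by case: I => [a| |]//; rewrite -EFinB abse_EFin lee_fin; exists a. Qed.

Lemma abse_le_fin (I : \bar R) (e : R) :
  (`|I| <= e%:E)%E -> exists2 a, I = a%:E & `|a| <= e.
Proof. by case: I => [a| |]//; rewrite abse_EFin lee_fin; exists a. Qed.

(* Test the weak derivative against a smoothed indicator of [x, y]: the left-hand
   side is a difference of local averages of [F], the right-hand side is bounded
   by Young's inequality with parameter [l]. *)
Lemma weak_deriv_oscillation F g (K l x y : R) :
  weak_deriv F g -> (\int[lam]_z (g z ^+ 2)%:E <= K%:E)%E -> 0 < l -> x < y ->
  finitely_continuous_at F x -> finitely_continuous_at F y ->
  `|fine (F y) - fine (F x)| <= l * K + (y - x) / l.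
Proof.
move=> [iF ig wd] gK l0 xy cx cy; apply/ler_addgt0Pr => e e0.
have [M M0 kb] := @kernel_bounds R.
have e10 : 0 < e / (4 * M) by rewrite divr_gt0// mulr_gt0.
have [hx hx0 Hx] := cx _ e10; have [hy hy0 Hy] := cy _ e10.
(* The width [h] keeps both averages within [e / 4] of the point values, separates the two supports,
   and makes the excess [h / l] at most [e / 2]: the errors add up to [e]. *)
pose h := Num.min (Num.min hx hy) (Num.min ((y - x) / 2) (e * l / 2)).
have h0 : 0 < h by rewrite !lt_min hx0 hy0 !divr_gt0 ?subr_gt0 ?mulr_gt0.
have [hhx hhy hyx hel] : [/\ h <= hx, h <= hy, h <= (y - x) / 2 & h <= e * l / 2].
  by split; rewrite /h !ge_min lexx ?orbT.
have near_pt (c hc z : R) : h <= hc -> `[c, c + h]%classic z -> `|z - c| <= hc.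
  move=> hhc /=; rewrite in_itv/= => /andP[cz zc].
  by rewrite ger0_norm ?subr_ge0//; lra.
have [ix Ax] := kernel_mean h0 (fun z => (kb x h z h0).1) (iF _ _)
  (fun z Dz => Hx z (near_pt _ _ _ hhx Dz)).
have [iy Ay] := kernel_mean h0 (fun z => (kb y h z h0).1) (iF _ _)
  (fun z Dz => Hy z (near_pt _ _ _ hhy Dz)).
have e1M : e / (4 * M) * M = e / 4 by field; rewrite gt_eqF.
rewrite e1M in Ax Ay.
have [a Ea {}Ax] := abse_sub_le_fin Ax; have [b Eb {}Ay] := abse_sub_le_fin Ay.
have := wd _ (testfun1_ramp h0 (ltW xy)).
pose phi : R -> R := fun z => ramp x h z - ramp y h z; rewrite -/phi.
have -> : (\int[lam]_z (F z * (derive1 phi z)%:E) = a%:E - b%:E)%E.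
  rewrite -Ea -Eb -(integralB (@measurableT _ (measurableTypeR R)) ix iy).
  apply: eq_integral => z _; rewrite /phi derive1_ramp.
  (* [F] may be infinite, so distributivity is not automatic; since the supports are disjoint, one
     of the two kernels vanishes at each [z]. *)
  have [zx|zx] := pselect (`[x, x + h]%classic z).
    rewrite (kernel_out h0 (x := y))//; last first.
      move: zx => /=; rewrite !in_itv/= => /andP[_ zx] /andP[yz _].
      by have := le_trans yz zx; rewrite leNgt => /negP; apply; lra.
    by rewrite subr0 mule0 sube0.
  by rewrite (kernel_out _ zx)// sub0r mule0 sub0e EFinN muleN.
have [c -> Ic] := abse_le_fin (integral_ramp_le ig gK l0 h0 (ltW xy)).
rewrite -EFinN -EFinB => -[abc].
have hl : h / l <= e / 2 by rewrite ler_pdivrMr//; lra.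
have yhl : (y - x + h) / l = (y - x) / l + h / l by field; rewrite gt_eqF.
move: Ax Ay Ic; rewrite yhl !ler_norml => /andP[? ?] /andP[? ?] /andP[? ?].
by apply/andP; split; lra.
Qed.

End WeakDerivative.

(** * Powers and logarithm of the density *)

Section PowerScales.
Context {R : realType}.
Local Notation lam := (@lebesgue_measure R).
Implicit Types (r : R -> R) (x y : R).

Lemma near_radius (P : R -> Prop) x : (\near x, P x) ->
  exists2 h, 0 < h & forall z, `|z - x| <= h -> P z.
Proof.
move=> /nbhs_ballP[d /= d0 dP]; exists (d / 2) => [|z zx]; first by rewrite divr_gt0.
apply: dP; rewrite -ball_normE /= distrC (le_lt_trans zx)//.
by rewrite ltr_pdivrMr// ltr_pMr// ltr1n.
Qed.

Lemma finitely_continuous_comp (F : R -> \bar R) (f : R -> R) r x :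
  {for r x, continuous f} -> {for x, continuous r} ->
  (\near x, F x = (f (r x))%:E) -> finitely_continuous_at F x.
Proof.
move=> cf cr Ff e e0.
have Fx : F x = (f (r x))%:E by exact: (nbhs_singleton Ff).
have cfr : {for x, continuous (f \o r)} by exact: continuous_comp cr cf.
have near_le : \forall z \near x, `|f (r z) - fine (F x)| <= e.
  have /cvgrPdist_le/(_ e e0) := cfr; apply: filterS => z /=.
  by rewrite Fx /= distrC.
have [h h0 hP] := near_radius (filterI Ff near_le).
by exists h => // z /hP[-> ?]; rewrite -EFinB abse_EFin lee_fin.
Qed.

Lemma near_gt0 r x : {for x, continuous r} -> 0 < r x -> \near x, 0 < r x.
Proof. by move=> cr r0; exact: (cr _ (lt_nbhsr r0)). Qed.

Lemma continuous_powR_gt0 p x : 0 < x -> {for x, continuous (fun s : R => s `^ p)}.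
Proof.
move=> x0; apply: differentiable_continuous; apply/derivable1_diffP.
by have [] := is_derive1_powR p x0.
Qed.

(** Away from zeros of [r] the power is differentiable. At a zero, finiteness forces [p > 0], and
    [r z <= e^(1/p)] is the condition that makes the power at most [e]. *)
Lemma finitely_continuous_epow p r x : p != 0 -> {for x, continuous r} ->
  (forall z, 0 <= r z) -> epow p (r x) \is a fin_num ->
  finitely_continuous_at (fun z => epow p (r z)) x.
Proof.
move=> p0 cr r0 fin.
have [rx0|rx0] := eqVneq (r x) 0; last first.
  have rxgt : 0 < r x by rewrite lt_neqAle eq_sym rx0 r0.
  apply: (@finitely_continuous_comp _ (fun s => s `^ p) r) => //.
    exact: continuous_powR_gt0.
  by have := near_gt0 cr rxgt; apply: filterS => z rz; rewrite /epow gt_eqF.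
have pgt : 0 < p.
  move: fin; rewrite /epow rx0 eqxx/=; case: ifP => // /negbT; rewrite -leNgt.
  by rewrite le_eqVlt eq_sym (negbTE p0).
have epowE z : epow p (r z) = (r z `^ p)%:E by rewrite /epow ltNge (ltW pgt) andbF.
move=> e e0; have e1 : 0 < e `^ p^-1 by rewrite powR_gt0.
have /cvgrPdist_le/(_ _ e1)/near_radius[h h0 hP] := cr.
exists h => // z /hP rz; rewrite !epowE; move: rz; rewrite rx0 sub0r normrN.
rewrite ger0_norm// => rz.
rewrite powR0// -EFinB subr0 abse_EFin lee_fin ger0_norm ?powR_ge0//.
have -> : e = (e `^ p^-1) `^ p by rewrite -powRrM mulVf// powRr1// ltW.
by apply: ge0_ler_powR => //; rewrite ?nnegrE ?powR_ge0// ltW.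
Qed.

Lemma finitely_continuous_elog r x : {for x, continuous r} ->
  (forall z, 0 <= r z) -> elog (r x) \is a fin_num ->
  finitely_continuous_at (fun z => elog (r z)) x.
Proof.
move=> cr r0 fin.
have rxgt : 0 < r x.
  by rewrite lt_neqAle r0 andbT eq_sym; move: fin; rewrite /elog; case: ifP.
apply: (@finitely_continuous_comp _ (@ln R) r) => //; first exact: continuous_ln.
by have := near_gt0 cr rxgt; apply: filterS => z rz; rewrite /elog gt_eqF.
Qed.

Lemma finitely_continuous_Dfun alpha r x : {for x, continuous r} ->
  (forall z, 0 <= r z) -> Dfun alpha (r x) \is a fin_num ->
  finitely_continuous_at (fun z => Dfun alpha (r z)) x.
Proof.
move=> cr r0; rewrite /Dfun; case: ifPn => [_|na]; first exact: finitely_continuous_elog.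
by apply: finitely_continuous_epow => //; rewrite subr_eq0.
Qed.

(* Values [b + e <= a <= C] have ratio [b / a] at most [theta C e < 1]. *)
Definition theta (C e : R) := (`|C| + 1) / (`|C| + 1 + e).

Lemma theta_itv C e : 0 < e -> 0 < theta C e < 1.
Proof.
move=> e0; have C0 : 0 < `|C| + 1 by rewrite ltr_wpDl.
have D0 : 0 < `|C| + 1 + e by rewrite addr_gt0.
rewrite /theta divr_gt0//=.
by rewrite ltr_pdivrMr// mul1r ltrDl.
Qed.

Lemma le_theta C e a b : 0 < e -> 0 <= b -> b + e <= a -> a <= C ->
  b <= theta C e * a.
Proof.
move=> e0 b0 ba aC; have C0 : 0 < `|C| + 1 by rewrite ltr_wpDl.
have Cn := ler_norm C.
apply: (@le_trans _ _ (theta C e * (b + e))); last first.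
  by rewrite ler_pM2l//; case/andP: (theta_itv C e0).
rewrite /theta mulrAC ler_pdivlMr; last by rewrite addr_gt0.
rewrite -subr_ge0.
have -> : (`|C| + 1) * (b + e) - b * (`|C| + 1 + e) = (`|C| + 1 - b) * e by ring.
by rewrite mulr_ge0 ?(ltW e0)//; lra.
Qed.

(** The ratio bound [b <= theta * a] is raised to the power [|p|]. For [p > 0] the gap is at least
    [a^p (1 - theta^p)], and [a >= e]. For [p < 0] it is at least [(1 - theta^(-p)) b^p], and [b] is
    at most [|C| + 1]; finiteness then excludes [b = 0], where [fine] would return a default
    value. *)
Lemma epow_separated p (C e : R) : p != 0 -> 0 < e -> exists2 d, 0 < d &
  forall a b, 0 <= b -> b + e <= a -> a <= C ->
    epow p b \is a fin_num -> d <= `|fine (epow p a) - fine (epow p b)|.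
Proof.
move=> p0 e0; have /andP[t0 t1] := theta_itv C e0.
have C0 : 0 < `|C| + 1 by rewrite ltr_wpDl.
have epowE s : epow p s \is a fin_num -> fine (epow p s) = s `^ p.
  by rewrite /epow; case: ifP.
have pow_lt1 q : 0 < q -> theta C e `^ q < 1.
  move=> q0; rewrite -[ltRHS](_ : 1 `^ q = 1); last by rewrite powR1.
  by apply: gt0_ltr_powR => //; rewrite nnegrE ltW.
have le_pow q a b : 0 < q -> 0 <= b -> b + e <= a -> a <= C ->
    b `^ q <= theta C e `^ q * a `^ q.
  move=> q0 b0 ba aC; rewrite -powRM ?(ltW t0)//; last by lra.
  apply: ge0_ler_powR => //; rewrite ?nnegrE ?(ltW q0)//.
    by rewrite mulr_ge0 ?(ltW t0)//; lra.
  exact: le_theta.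
have epow_fin a b : 0 <= b -> b + e <= a -> epow p a \is a fin_num.
  by move=> b0 ba; rewrite /epow gt_eqF//; lra.
have [pgt|plt|peq] := ltgtP 0 p; last by rewrite peq eqxx in p0.
- exists (e `^ p * (1 - theta C e `^ p)).
    by rewrite mulr_gt0 ?powR_gt0// subr_gt0 pow_lt1.
  move=> a b b0 ba aC fb; rewrite !epowE ?(epow_fin a b)//.
  have := le_pow p a b pgt b0 ba aC; have t1p := pow_lt1 p pgt.
  have ea : e `^ p <= a `^ p by apply: ge0_ler_powR; rewrite ?nnegrE; lra.
  have : e `^ p * (1 - theta C e `^ p) <= a `^ p * (1 - theta C e `^ p).
    by rewrite ler_wpM2r// subr_ge0 ltW.
  by move=> h1 h2; apply: le_trans (ler_norm _); lra.
- have q0 : 0 < - p by rewrite oppr_gt0.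
  exists ((1 - theta C e `^ (- p)) / (`|C| + 1) `^ (- p)).
    by rewrite divr_gt0 ?powR_gt0// subr_gt0 pow_lt1.
  move=> a b b0 ba aC fb; rewrite !epowE ?(epow_fin a b)//.
  have bgt : 0 < b.
    by rewrite lt_neqAle b0 andbT eq_sym; move: fb; rewrite /epow plt andbT; case: ifP.
  have h := le_pow _ _ _ q0 b0 ba aC; have tq := pow_lt1 _ q0.
  have aCq : a `^ (- p) <= (`|C| + 1) `^ (- p).
    have := ler_norm C; move=> ?.
    by apply: ge0_ler_powR; rewrite ?nnegrE; lra.
  have A0 : 0 < a `^ (- p) by rewrite powR_gt0//; lra.
  have B0 : 0 < b `^ (- p) by rewrite powR_gt0.
  rewrite -[X in a `^ X]opprK -[X in b `^ X]opprK (powRN a) (powRN b).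
  move: h tq aCq A0 B0.
  set A := a `^ (- p); set B := b `^ (- p); set t := theta C e `^ (- p).
  set D := (`|C| + 1) `^ (- p) => BtA tlt AD A0 B0.
  have tge : 0 <= t by exact: powR_ge0.
  have BA : B <= A by nra.
  rewrite distrC; apply: le_trans (ler_norm _).
  apply: (@le_trans _ _ ((1 - t) / B)).
    rewrite ler_pM2l ?subr_gt0// lef_pV2 ?posrE//; lra.
  have -> : B^-1 - A^-1 = (1 - B / A) / B by field; rewrite !gt_eqF.
  rewrite ler_pM2r ?invr_gt0// lerD2l lerN2 ler_pdivrMr//.
Qed.

Lemma elog_separated (C e : R) : 0 < e -> exists2 d, 0 < d &
  forall a b, 0 <= b -> b + e <= a -> a <= C ->
    elog b \is a fin_num -> d <= `|fine (elog a) - fine (elog b)|.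
Proof.
move=> e0; have /andP[t0 t1] := theta_itv C e0.
exists (- ln (theta C e)); first by rewrite oppr_gt0 ln_lt0// t0.
move=> a b b0 ba aC fb.
have bgt : 0 < b.
  by rewrite lt_neqAle b0 andbT eq_sym; move: fb; rewrite /elog; case: ifP.
have agt : 0 < a by lra.
rewrite /elog !gt_eqF//=; apply: le_trans (ler_norm _).
have : ln b <= ln (theta C e * a).
  by rewrite ler_ln ?posrE ?(mulr_gt0 t0 agt)//; exact: (@le_theta C e a b).
by rewrite lnM ?posrE//; lra.
Qed.

Lemma Dfun_separated alpha (C e : R) : 0 < e -> exists2 d, 0 < d &
  forall a b, 0 <= b -> b + e <= a -> a <= C ->
    Dfun alpha b \is a fin_num -> d <= `|fine (Dfun alpha a) - fine (Dfun alpha b)|.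
Proof.
move=> e0; rewrite /Dfun; have [_|na] := eqVneq alpha 2^-1; first exact: elog_separated.
by apply: epow_separated => //; rewrite subr_eq0.
Qed.

End PowerScales.

(** * Estimates at a fixed time *)

Section FixedTime.
Context {R : realType}.
Local Notation lam := (@lebesgue_measure R).
Implicit Types (r g : R -> R) (x y : R).

Lemma weak_deriv_oscillation_le (F : R -> \bar R) g (K l L : R) x y :
  weak_deriv F g -> (\int[lam]_z (g z ^+ 2)%:E <= K%:E)%E -> 0 < l ->
  `|x - y| <= L -> finitely_continuous_at F x -> finitely_continuous_at F y ->
  `|fine (F x) - fine (F y)| <= l * K + L / l.
Proof.
move=> wF gK l0 xyL cx cy.
have K0 : 0 <= K.
  have : (0 <= \int[lam]_z (g z ^+ 2)%:E)%E.
    by apply: integral_ge0 => z _; rewrite lee_fin sqr_ge0.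
  by move=> /le_trans/(_ gK); rewrite lee_fin.
have Ll : `|x - y| / l <= L / l by rewrite ler_pM2r ?invr_gt0.
have [xy|yx|->] := ltgtP x y.
- rewrite distrC; apply: le_trans (weak_deriv_oscillation wF gK l0 xy cx cy) _.
  by rewrite lerD2l -(gtr0_norm (_ : 0 < y - x)) ?subr_gt0// distrC.
- apply: le_trans (weak_deriv_oscillation wF gK l0 yx cy cx) _.
  by rewrite lerD2l -(gtr0_norm (_ : 0 < x - y)) ?subr_gt0.
- rewrite subrr normr0 addr_ge0 ?mulr_ge0 ?(ltW l0)// ?invr_ge0 ?(ltW l0)//.
  exact: le_trans (normr_ge0 _) xyL.
Qed.

(** An integrable function is finite almost everywhere. This replaces a vacuum point by a nearby one
    at which the oscillation estimate applies. *)
Lemma locally_integrable_dense (F : R -> \bar R) x (h : R) :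
  (forall a b : R, lam.-integrable `[a, b] F) -> 0 < h ->
  exists2 z, `|z - x| <= h & F z \is a fin_num.
Proof.
move=> iF h0.
have mD : @measurable _ (measurableTypeR R) `[x - h, x + h]%classic.
  exact: measurable_itv.
have aeF := integrable_ae mD (iF (x - h) (x + h)).
have [||z [/andP[z1 z2] Fz]] := @ae_dense _ (fun z => F z \is a fin_num) (x - h) (x + h).
- apply: ae_imply aeF => z Fz /andP[z1 z2]; apply: Fz => /=.
  by rewrite in_itv/= !ltW.
- lra.
by exists z => //; rewrite ler_norml; apply/andP; split; lra.
Qed.

(** Densities that differ by more than [e] at distance [eta] would force a gap [d] between values of
    [Dfun] that the energy bound forbids. Since [eta] is fixed before [r] and [g], it will not
    depend on time. *)
Lemma equicontinuous_profile (alpha C e : R) : 0 < e -> exists2 eta, 0 < eta &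
  forall r g, continuous r -> (forall z, 0 <= r z <= C) ->
    weak_deriv (fun z => Dfun alpha (r z)) g ->
    (\int[lam]_z (g z ^+ 2)%:E <= C%:E)%E ->
    forall x y, `|x - y| <= eta -> `|r x - r y| <= e.
Proof.
move=> e0; have e20 : 0 < e / 2 by rewrite divr_gt0.
have [d d0 sep] := Dfun_separated alpha C e20.
have C10 : 0 < `|C| + 1 by rewrite ltr_wpDl.
(* With this [l], [l * C <= d / 4], and with [eta = l * d / 8] points at distance [2 * eta] add
   another [d / 4]: the oscillation is at most [d / 2 < d]. *)
pose l := d / (4 * (`|C| + 1)); have l0 : 0 < l by rewrite divr_gt0// mulr_gt0.
exists (l * d / 8) => [|r g cr rC wd gC x y xy]; first by rewrite !mulr_gt0// invr_gt0.
have eta0 : 0 < l * d / 8 by rewrite !mulr_gt0// invr_gt0.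
set eta := l * d / 8 in xy eta0.
rewrite leNgt; apply/negP => far.
have e40 : 0 < e / 4 by rewrite divr_gt0.
have iF : forall a b : R, lam.-integrable `[a, b] (fun z => Dfun alpha (r z)).
  by case: wd.
(* Each point moves by at most [eta / 2] and each density changes by at most [e / 4], so a gap of
   [e / 2] survives. *)
have good w : exists z, [/\ `|z - w| <= eta / 2, `|r w - r z| <= e / 4 &
    Dfun alpha (r z) \is a fin_num].
  have /cvgrPdist_le/(_ _ e40)/near_radius[h h0 hP] := cr w.
  have m0 : 0 < Num.min h (eta / 2) by rewrite lt_min h0 divr_gt0.
  have [z] := locally_integrable_dense w iF m0.
  by rewrite le_min => /andP[zh ze] fz; exists z; split => //; exact: hP.
have [x' [x'x rx fx]] := good x; have [y' [y'y ry fy]] := good y.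
have x'y' : `|x' - y'| <= 2 * eta.
  move: xy x'x y'y; rewrite !ler_norml => /andP[? ?] /andP[? ?] /andP[? ?].
  by apply/andP; split; lra.
have cx := finitely_continuous_Dfun (cr x') (fun z => proj1 (andP (rC z))) fx.
have cy := finitely_continuous_Dfun (cr y') (fun z => proj1 (andP (rC z))) fy.
have := weak_deriv_oscillation_le wd gC l0 x'y' cx cy.
have -> : 2 * eta / l = d / 4 by rewrite /eta; field; rewrite gt_eqF.
have lC : l * C <= d / 4.
  have -> : d / 4 = l * (`|C| + 1) by rewrite /l; field; rewrite gt_eqF.
  by rewrite ler_pM2l//; have := ler_norm C; lra.
have dle : d <= `|fine (Dfun alpha (r x')) - fine (Dfun alpha (r y'))|.
  have /andP[rx'0 rx'C] := rC x'; have /andP[ry'0 ry'C] := rC y'.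
  move: far rx ry; rewrite lter_normr !ler_norml => far /andP[? ?] /andP[? ?].
  have [h|h] : r y' + e / 2 <= r x' \/ r x' + e / 2 <= r y'.
    by case/orP: far => ?; [left|right]; lra.
  - exact: sep.
  - by rewrite distrC; exact: sep.
by move=> h; have := le_trans dle h; rewrite leNgt => /negP; apply; lra.
Qed.

(** Chebyshev-type bound by comparison with a step function, applicable to the dissipation as a
    function of time. *)
Lemma cst_le_integral d (T : measurableType d) (mu : {measure set T -> \bar R})
    (A D : set T) (f : T -> \bar R) (c : R) :
  measurable D -> D `<=` A -> 0 <= c -> (forall z, A z -> (0 <= f z)%E) ->
  (forall z, D z -> (c%:E <= f z)%E) -> (c%:E * mu D <= \int[mu]_(z in A) f z)%E.
Proof.
move=> mD DA c0 f0 cf; rewrite -(integral_cst mu mD).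
have -> : (\int[mu]_(z in D) cst c%:E z = \int[mu]_(z in A) (cst c%:E \_ D) z)%E.
  by rewrite -integral_mkcondr setIidr.
apply: le_integral_nonmeasurable => z Az; rewrite patchE.
  by case: ifPn => // _; rewrite /= lee_fin.
by case: ifPn => [/set_mem Dz|_]; [exact: cf|exact: f0].
Qed.

Lemma close_point (rb C e : R) : 0 <= rb -> 0 < e -> exists2 L, 0 < L & forall r,
  (forall z, 0 <= r z) ->
  (0 < rb -> (\int[lam]_z ((r z - rb) ^+ 2)%:E <= C%:E)%E) ->
  (rb = 0 -> (\int[lam]_z (r z)%:E <= C%:E)%E) ->
  forall x, exists2 y, `|x - y| <= L & `|r y - rb| < e.
Proof.
move=> rb0 e0; have C10 : 0 < `|C| + 1 by rewrite ltr_wpDl.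
have CC : C < `|C| + 1 by have := ler_norm C; lra.
(* A deviation of at least [e] on all of [[x, x + L]] would give an integral of at least [e^2 L] (if
   [rb > 0]) or [e L] (if [rb = 0]). The sum makes both exceed [C]. *)
pose L := (`|C| + 1) / e ^+ 2 + (`|C| + 1) / e.
have L1 : 0 < (`|C| + 1) / e ^+ 2 by rewrite divr_gt0// exprn_gt0.
have L2 : 0 < (`|C| + 1) / e by rewrite divr_gt0.
have L0 : 0 < L by rewrite addr_gt0.
exists L => // r r0 int_pos int_0 x; apply: contrapT => far.
set D := `[x, x + L]%classic.
have mD : @measurable _ (measurableTypeR R) D by exact: measurable_itv.
have muD : (lam D = L%:E)%E.
  by rewrite /D lebesgue_measure_itv/= lte_fin ltrDl L0 -EFinD addrC addKr.
have farD z : D z -> e <= `|r z - rb|.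
  rewrite /D/= in_itv/= => /andP[xz zx]; rewrite leNgt; apply/negP => rz.
  by apply: far; exists z => //; rewrite distrC ger0_norm ?subr_ge0//; lra.
have [rbe|rbgt] := eqVneq rb 0.
  have eD z : D z -> (e%:E <= (r z)%:E)%E.
    by move/farD; rewrite rbe subr0 ger0_norm.
  have lb : (e%:E * lam D <= \int[lam]_z (r z)%:E)%E.
    have r0E z : setT z -> (0 <= (r z)%:E)%E by rewrite lee_fin.
    exact: (@cst_le_integral _ (measurableTypeR R) lam setT D _ e mD
      (@subsetT _ _) (ltW e0) r0E eD).
  move: (le_trans lb (int_0 rbe)); rewrite muD -EFinM lee_fin leNgt => /negP; apply.
  apply: lt_le_trans CC _; rewrite /L mulrDr [e * (_ / e)]mulrC divfK ?gt_eqF//.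
  by rewrite lerDr ltW// mulr_gt0.
have rb1 : 0 < rb by rewrite lt_neqAle eq_sym rbgt.
have eD z : D z -> ((e ^+ 2)%:E <= ((r z - rb) ^+ 2)%:E)%E.
  move=> Dz; rewrite lee_fin -(real_normK (num_real (r z - rb))).
  by rewrite ler_pXn2r ?nnegrE ?(ltW e0)//; exact: farD.
have lb : ((e ^+ 2)%:E * lam D <= \int[lam]_z ((r z - rb) ^+ 2)%:E)%E.
  have sqE z : setT z -> (0 <= ((r z - rb) ^+ 2)%:E)%E by rewrite lee_fin sqr_ge0.
  exact: (@cst_le_integral _ (measurableTypeR R) lam setT D _ (e ^+ 2) mD
    (@subsetT _ _) (sqr_ge0 e) sqE eD).
move: (le_trans lb (int_pos rb1)); rewrite muD -EFinM lee_fin leNgt => /negP; apply.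
apply: lt_le_trans CC _; rewrite /L mulrDr [e ^+ 2 * (_ / e ^+ 2)]mulrC.
by rewrite divfK ?expf_neq0 ?gt_eqF// lerDl ltW// mulr_gt0// exprn_gt0.
Qed.

Lemma dissipation_lower_bound (beta rb C e : R) : 0 < beta -> 0 <= rb -> 0 < e ->
  exists2 c, 0 < c & forall r g, continuous r -> (forall z, 0 <= r z <= C) ->
    (0 < rb -> (\int[lam]_z ((r z - rb) ^+ 2)%:E <= C%:E)%E) ->
    (rb = 0 -> (\int[lam]_z (r z)%:E <= C%:E)%E) ->
    weak_deriv (fun z => epow beta (r z)) g ->
    (exists x, e < `|r x - rb|) -> (c%:E <= \int[lam]_z (g z ^+ 2)%:E)%E.
Proof.
move=> beta0 rb0 e0; have e20 : 0 < e / 2 by rewrite divr_gt0.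
have [d d0 sep] := epow_separated C (lt0r_neq0 beta0) e20.
have [L L0 close] := close_point C rb0 e20.
(* With dissipation at most [c = d^2 / (8 L)], the oscillation over distance [L] is at most
   [l c + L / l = d / 4 + d / 2], below the gap [d]. *)
pose l := 2 * L / d; have l0 : 0 < l by rewrite divr_gt0// mulr_gt0.
exists (d ^+ 2 / (8 * L)) => [|r g cr rC i1 i2 wd [x far]].
  by rewrite divr_gt0 ?exprn_gt0// mulr_gt0.
have r0 z : 0 <= r z by case/andP: (rC z).
have fin z : epow beta (r z) \is a fin_num.
  by rewrite /epow [beta < 0]ltNge (ltW beta0) andbF.
rewrite leNgt; apply/negP => /ltW small.
have [y xy ry] := close r r0 i1 i2 x.
have cx := finitely_continuous_epow (lt0r_neq0 beta0) (cr x) r0 (fin x).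
have cy := finitely_continuous_epow (lt0r_neq0 beta0) (cr y) r0 (fin y).
have := weak_deriv_oscillation_le wd small l0 xy cx cy.
have -> : l * (d ^+ 2 / (8 * L)) + L / l = d * (3 / 4).
  by rewrite /l; field; rewrite !gt_eqF.
have dle : d <= `|fine (epow beta (r x)) - fine (epow beta (r y))|.
  have /andP[rx0 rxC] := rC x; have /andP[ry0 ryC] := rC y.
  move: far ry; rewrite lter_normr ltr_norml => far /andP[? ?].
  have [h|h] : r y + e / 2 <= r x \/ r x + e / 2 <= r y.
    by case/orP: far => ?; [left|right]; lra.
  - exact: sep.
  - by rewrite distrC; exact: sep.
by move=> h; have := le_trans dle h; rewrite leNgt => /negP; apply; lra.
Qed.

End FixedTime.

(** * Local averages of the mass *)

Section Density.
Context {R : realType}.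
Local Notation lam := (@lebesgue_measure R).
Implicit Types (rho u Dr Gr : R -> R -> R) (x y t s : R).

(* Young's inequality, after dividing by [rb `^ gamma]. *)
Lemma rhoPsi_ge0 (gamma rb s : R) : 1 < gamma -> 0 <= rb -> 0 <= s ->
  0 <= rhoPsi gamma rb s.
Proof.
move=> g1 rb0 s0; have g0 : 0 < gamma by lra.
rewrite /rhoPsi divr_ge0//; last by lra.
have [->|rbn0] := eqVneq rb 0.
  rewrite powR0 ?gt_eqF// powR0; last by rewrite gt_eqF// subr_gt0.
  by rewrite mulr0 mul0r !subr0 powR_ge0.
have rbgt : 0 < rb by rewrite lt_neqAle eq_sym rbn0.
have conj : gamma^-1 + (gamma / (gamma - 1))^-1 = 1.
  by rewrite invf_div; field; rewrite !gt_eqF ?subr_gt0.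
have q0 : 0 < gamma / (gamma - 1) by rewrite divr_gt0// subr_gt0.
have := conjugate_powR (divr_ge0 s0 rb0) ler01 g0 q0 conj.
rewrite powR1 mulr1 mul1r invf_div => young.
have sE : s = s / rb * rb by rewrite divfK.
have sg : s `^ gamma = (s / rb) `^ gamma * rb `^ gamma.
  by rewrite -powRM ?divr_ge0// divfK.
have rbg : rb `^ (gamma - 1) * rb = rb `^ gamma by rewrite mulrC mulr_powRB1.
have -> : s `^ gamma - rb `^ gamma - gamma * rb `^ (gamma - 1) * (s - rb) =
    rb `^ gamma * ((s / rb) `^ gamma - 1 - gamma * (s / rb - 1)).
  by rewrite sg -rbg; field.
rewrite mulr_ge0 ?powR_ge0//.
move: young; set w := (s / rb) `^ gamma; set v := s / rb => young.
have : v * gamma <= (w / gamma + (gamma - 1) / gamma) * gamma by rewrite ler_pM2r.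
have -> : (w / gamma + (gamma - 1) / gamma) * gamma = w + gamma - 1.
  by field; rewrite gt_eqF.
by lra.
Qed.

Lemma C1_2_space (f : R -> R) : smooth f -> C1_2 (fun x _ => f x).
Proof.
move=> sf; have sf' := smooth_derive1 sf.
have dtE : dt (fun x (_ : R) => f x) = fun _ _ => 0.
  by apply/funext => x; apply/funext => t; exact: derive1_cst.
split.
- by move=> x t; split; [exact: (sf 0%N x)|exact: derivable_cst].
- move=> z; apply: (@continuous_comp _ _ _ fst f); first exact: cvg_fst.
  exact: smooth_continuous.
- move=> z; apply: (@continuous_comp _ _ _ fst (derive1 f)); first exact: cvg_fst.
  exact: smooth_continuous.
- by rewrite dtE => z; exact: cst_continuous.
Qed.

(** On the support, [r |v| |k'| <= r v^2 + r B^2]: the first term is the kinetic energy, the second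
    integrates to at most [C B^2 h]. The bound does not depend on [x0]. *)
Lemma flux_integral_le (C h B x0 : R) (r v k' : R -> R) : 0 < h ->
  (forall x, 0 <= r x <= C) -> (forall x, `|k' x| <= B) ->
  (forall x, ~ `[x0, x0 + h]%classic x -> k' x = 0) ->
  @measurable_fun _ _ (measurableTypeR R) R setT (fun x => Num.sqrt (r x) * v x) ->
  (\int[lam]_x ((Num.sqrt (r x) * v x) ^+ 2)%:E <= C%:E)%E ->
  (`|\int[lam]_x (r x * v x * k' x)%:E| <= (C + C * B ^+ 2 * h)%:E)%E.
Proof.
move=> h0 rC kB k0 mv vC; set D := `[x0, x0 + h]%classic.
have C0 : 0 <= C by case/andP: (rC 0) => a b; exact: le_trans b.
have mD : @measurable _ (measurableTypeR R) D by exact: measurable_itv.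
have muD : (lam D = h%:E)%E.
  by rewrite /D lebesgue_measure_itv/= lte_fin ltrDl h0 -EFinD addrC addKr.
pose b x : \bar R := (((Num.sqrt (r x) * v x) ^+ 2)%:E + (C * B ^+ 2)%:E * (\1_D x)%:E)%E.
apply: (@le_trans _ _ (\int[lam]_x b x)%E).
  apply: abse_integral_le => x _; rewrite /b -EFinM -EFinD lee_fin.
  have /andP[r0 rx] := rC x.
  have sq0 : 0 <= (Num.sqrt (r x) * v x) ^+ 2 by exact: sqr_ge0.
  have [Dx|Dx] := pselect (D x); last first.
    by rewrite k0// mulr0 normr0 addr_ge0// mulr_ge0 ?indicE ?ler0n// mulr_ge0 ?sqr_ge0.
  rewrite indicE mem_set// mulr1 exprMn sqr_sqrtr// !normrM (ger0_norm r0).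
  apply: (@le_trans _ _ (r x * v x ^+ 2 + r x * B ^+ 2)); last first.
    by rewrite lerD2l ler_wpM2r// sqr_ge0.
  rewrite -mulrDr -mulrA ler_wpM2l// -(real_normK (num_real (v x))).
  have := kB x; have := normr_ge0 (v x); have := normr_ge0 (k' x).
  move: `|v x| `|k' x| => V W W0 V0 WB.
  have : V * W <= V * B by rewrite ler_wpM2l.
  have := sqr_ge0 (V - B); have := mulr_ge0 V0 (le_trans W0 WB); nra.
have CB0 : 0 <= C * B ^+ 2 by rewrite mulr_ge0// sqr_ge0.
rewrite /b ge0_integralD//; last 4 first.
- by move=> x _; rewrite lee_fin sqr_ge0.
- by apply/measurable_EFinP; exact: measurable_funX.
- by move=> x _; rewrite -EFinM lee_fin mulr_ge0.
- apply: (@measurable_funeM _ (measurableTypeR R)).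
  by apply/measurable_EFinP; exact: measurable_indic.
rewrite ge0_integralZl//; last first.
- by apply/measurable_EFinP; exact: measurable_indic.
have -> : (\int[lam]_x (\1_D x)%:E = lam D)%E.
  by have := integral_indic lam measurableT mD; rewrite setIT.
by rewrite muD -EFinM EFinD leeD2r.
Qed.

Lemma jointly_measurable_slice (f : R -> R -> R) t : jointly_measurable f ->
  @measurable_fun _ _ (measurableTypeR R) R setT (fun x => f x t).
Proof.
move=> mf; have := measurableT_comp mf (@pair2_measurable _ _ R R t).
by [].
Qed.

Lemma mass_average_lipschitz (C h : R) rho u : 0 < h ->
  (forall x t, 0 <= rho x t) -> (forall x t, 0 <= t -> rho x t <= C) ->
  jointly_measurable (fun x t => Num.sqrt (rho x t) * u x t) ->
  {ae lam, forall t, 0 < t ->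
    (\int[lam]_x ((Num.sqrt (rho x t) * u x t) ^+ 2)%:E <= C%:E)%E} ->
  (forall zeta t1 t2, C1_2 zeta ->
     (exists K : R, forall x t, K < `|x| -> zeta x t = 0) -> 0 <= t1 -> t1 <= t2 ->
     \int[lam]_x (rho x t2 * zeta x t2) - \int[lam]_x (rho x t1 * zeta x t1)
     = \int[lam]_(t in `[t1, t2]) \int[lam]_x
          (rho x t * dt zeta x t + rho x t * u x t * dx zeta x t)) ->
  exists2 K, 0 < K & forall x0 t1 t2, 0 < t1 -> t1 <= t2 ->
    `|\int[lam]_x (rho x t2 * kernel x0 h x) - \int[lam]_x (rho x t1 * kernel x0 h x)|
      <= K * (t2 - t1).
Proof.
move=> h0 rho0 rhoC mv vC mass.
have [M M0 kb] := @kernel_bounds R.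
have C0 : 0 <= C := le_trans (rho0 0 0) (rhoC 0 0 (lexx 0)).
pose B := M / h ^+ 2.
set K := C + C * B ^+ 2 * h.
have K0 : 0 <= K.
  by rewrite addr_ge0// mulr_ge0 ?(ltW h0)// mulr_ge0 ?sqr_ge0.
(* The added 1 makes the constant strictly positive even when [K = 0]. *)
exists (K + 1) => [|x0 t1 t2 t10 t12]; first by rewrite ltr_wpDl.
pose zeta x (_ : R) := kernel x0 h x.
have zetaC : C1_2 zeta by exact: C1_2_space (@smooth_kernel R x0 h).
have zeta_supp : exists L : R, forall x t, L < `|x| -> zeta x t = 0.
  exists (`|x0| + h) => x t hx; apply: (@kernel_out _ x0 h h0 x) => /=.
  rewrite in_itv/= => /andP[h1 h2].
  move: hx; rewrite ltNge => /negP; apply; rewrite ler_norml.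
  have := ler_norm x0; have := ler_norm (- x0); rewrite normrN => ? ?.
  by apply/andP; split; lra.
rewrite (mass zeta t1 t2 zetaC zeta_supp (ltW t10) t12).
have mI : @measurable _ (measurableTypeR R) `[t1, t2]%classic by exact: measurable_itv.
have muI : (lam `[t1, t2]%classic = (t2 - t1)%:E)%E.
  rewrite lebesgue_measure_itv/= lte_fin; have [_|t21] := ltP t1 t2.
    by rewrite -EFinD.
  by rewrite (_ : t2 = t1) ?subrr//; apply/le_anti; rewrite t21 t12.
(* The kernel is stationary, so only the flux term remains. Its extended integral is finite by the
   flux bound, so the [fine] inside the real-valued integral loses nothing. *)
have inner : {ae lam, forall t, `[t1, t2]%classic t ->
    (`|(\int[lam]_x (rho x t * dt zeta x t + rho x t * u x t * dx zeta x t)%R)%:E|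
       <= K%:E)%E}.
  apply: ae_imply vC => t vC /=; rewrite in_itv/= => /andP[t1t _].
  have t0 : 0 < t := lt_le_trans t10 t1t.
  have := @flux_integral_le C h B x0 (rho^~ t) (u^~ t) (derive1 (kernel x0 h)) h0
    (fun x => introT andP (conj (rho0 x t) (rhoC x t (ltW t0))))
    (fun x => (kb x0 h x h0).2) (@derive1_kernel_out _ x0 h h0)
    (jointly_measurable_slice t mv) (vC t0).
  rewrite /Rintegral -/K.
  under [X in _ -> (`|(fine X)%:E| <= _)%E]eq_integral => x _.
    have -> : dt zeta x t = 0 by exact: derive1_cst.
    rewrite mulr0 add0r; over.
  by move=> /abse_le_fin[c -> cK]; rewrite abse_EFin lee_fin.
have := abse_integral_ae_le_cst mI K0 inner.
rewrite /Rintegral => outer.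
have {}outer : (`|\int[lam]_(t in `[t1, t2]) (fine (\int[lam]_x
    (rho x t * dt zeta x t + rho x t * u x t * dx zeta x t)%:E))%:E|
      <= (K * (t2 - t1))%:E)%E by rewrite EFinM -muI.
have [c -> cK] := abse_le_fin outer.
by apply: le_trans cK _; rewrite ler_wpM2r ?subr_ge0// lerDl.
Qed.

Lemma kernel_average (r : R -> R) (M h x c e : R) : 0 < h ->
  (forall z, `|kernel x h z| <= M / h) -> continuous r ->
  (forall z, `|x - z| <= h -> `|r z - c| <= e) ->
  `|\int[lam]_z (r z * kernel x h z) - c| <= e * M.
Proof.
move=> h0 kM cr rc.
have ir : lam.-integrable `[x, x + h] (fun z => (r z)%:E).
  apply: continuous_compact_integrable; first exact: segment_compact.
  exact: continuous_subspaceT.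
have rcE z : `[x, x + h]%classic z -> (`|(r z)%:E - c%:E| <= e%:E)%E.
  move=> Dz; rewrite -EFinB abse_EFin lee_fin; move: Dz => /=.
  rewrite in_itv/= => /andP[xz zx]; apply: rc.
  by rewrite distrC ger0_norm ?subr_ge0//; lra.
have [_] := kernel_mean h0 kM ir rcE.
by move=> /abse_sub_le_fin[a aE ac]; rewrite /Rintegral aE.
Qed.

End Density.

(** * Long-time behaviour *)

Section LongTime.
Context {R : realType}.
Local Notation lam := (@lebesgue_measure R).
Implicit Types (rho u Dr Gr : R -> R -> R) (x y t s : R).

(** Positive times form an open set, on which continuity relative to the closed half-plane is
    ordinary continuity. *)
Lemma continuous_positive_times rho :
  {within [set z : R * R | 0 <= z.2], continuous (fun z => rho z.1 z.2)} ->
  forall x t, 0 < t -> {for x, continuous (rho^~ t)} /\ {for t, continuous (rho x)}.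
Proof.
move=> cw x t t0.
pose A := [set z : R * R | 0 < z.2].
have oA : open A.
  have -> : A = snd @^-1` [set s : R | 0 < s] by [].
  by apply: open_comp; [move=> z _; exact: cvg_snd|exact: open_gt].
have cA : {within A, continuous (fun z : R * R => rho z.1 z.2)}.
  by apply: continuous_subspaceW cw => z /ltW.
rewrite continuous_open_subspace// in cA.
have cxt : {for (x, t), continuous (fun z : R * R => rho z.1 z.2)}.
  have Axt : (x, t) \in A by rewrite inE.
  exact: cA Axt.
split.
- apply: (@continuous_comp _ _ _ (fun y => (y, t)) (fun z : R * R => rho z.1 z.2)) => //.
  by apply: (@cvg_pair _ _ _ (nbhs x) (nbhs x) (nbhs t) _ _ _ id (cst t));
    [exact: cvg_id|exact: cvg_cst].
- apply: (@continuous_comp _ _ _ (fun s => (x, s)) (fun z : R * R => rho z.1 z.2)) => //.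
  by apply: (@cvg_pair _ _ _ (nbhs t) (nbhs x) (nbhs t) _ _ _ (cst x) id);
    [exact: cvg_cst|exact: cvg_id].
Qed.

(** For given [x], [y] and [t], continuity in time at the two points allows passing to a nearby time
    [s] at which the almost-everywhere bounds hold. The choice of [s] depends on the points, but
    [eta] does not. *)
Lemma equicontinuous_all_times (alpha C e : R) rho Dr :
  (forall x t, 0 < t -> {for x, continuous (rho^~ t)} /\ {for t, continuous (rho x)}) ->
  (forall x t, 0 < t -> 0 <= rho x t <= C) ->
  {ae lam, forall t, 0 < t ->
    weak_deriv (fun x => Dfun alpha (rho x t)) (Dr^~ t) /\
    (\int[lam]_x (Dr x t ^+ 2)%:E <= C%:E)%E} ->
  0 < e -> exists2 eta, 0 < eta & forall x y t, 0 < t ->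
    `|x - y| <= eta -> `|rho x t - rho y t| <= e.
Proof.
move=> crho rhoC aeD e0; have e30 : 0 < e / 3 by rewrite divr_gt0.
have [eta eta0 prof] := equicontinuous_profile alpha C e30.
exists eta => // x y t t0 xy.
have /cvgrPdist_le/(_ _ e30)/near_radius[hx hx0 Hx] := (crho x t t0).2.
have /cvgrPdist_le/(_ _ e30)/near_radius[hy hy0 Hy] := (crho y t t0).2.
pose h := Num.min t (Num.min hx hy).
have h0 : 0 < h by rewrite !lt_min t0 hx0 hy0.
have [ht hhx hhy] : [/\ h <= t, h <= hx & h <= hy].
  by split; rewrite /h !ge_min lexx ?orbT.
have [||s [/andP[s1 s2] [wd DrC]]] := @ae_dense _ (fun s =>
    weak_deriv (fun x => Dfun alpha (rho x s)) (Dr^~ s) /\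
    (\int[lam]_x (Dr x s ^+ 2)%:E <= C%:E)%E) (t - h) (t + h).
- by apply: ae_imply aeD => s Hs /andP[s1 _]; apply: Hs; lra.
- lra.
have s0 : 0 < s by lra.
have st : `|s - t| <= h by rewrite ler_norml; apply/andP; split; lra.
have := prof (rho^~ s) (Dr^~ s) (fun z => (crho z s s0).1)
  (fun z => rhoC z s s0) wd DrC x y xy.
have := Hx s (le_trans st hhx); have := Hy s (le_trans st hhy).
rewrite !ler_norml => /andP[? ?] /andP[? ?] /andP[? ?].
by apply/andP; split; lra.
Qed.

(* Mass moves at bounded speed, so a deviation of size [e] survives, up to a
   constant factor, on a time interval of fixed length. *)
Lemma deviation_persists (rb e : R) rho :
  (forall x t, 0 < t -> {for x, continuous (rho^~ t)}) ->
  (forall e, 0 < e -> exists2 eta, 0 < eta & forall x y t, 0 < t ->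
    `|x - y| <= eta -> `|rho x t - rho y t| <= e) ->
  (forall h, 0 < h -> exists2 K, 0 < K & forall x t1 t2, 0 < t1 -> t1 <= t2 ->
    `|\int[lam]_z (rho z t2 * kernel x h z) - \int[lam]_z (rho z t1 * kernel x h z)|
      <= K * (t2 - t1)) ->
  0 < e -> exists2 e', 0 < e' & exists2 tau, 0 < tau &
    forall x t, 0 < t -> e < `|rho x t - rb| -> forall s, t <= s -> s <= t + tau ->
      exists y, e' < `|rho y s - rb|.
Proof.
move=> crho equi mass e0; have [M M0 kb] := @kernel_bounds R.
have e10 : 0 < e / (4 * M) by rewrite divr_gt0// mulr_gt0.
have [h h0 osc] := equi _ e10.
have [K K0 lip] := mass _ h0.
(* If all deviations at time [s] were at most [e / (4 M)], three errors of [e / 4] would accumulate: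
   the average at [s] against [rb], the drift of the average up to time [tau], and the average at
   [t] against [rho x t]. Their sum is below [e]. *)
exists (e / (4 * M)) => //; exists (e / (4 * K)); first by rewrite divr_gt0// mulr_gt0.
move=> x t t0 far s ts st; apply: contrapT => near_s.
have s0 : 0 < s := lt_le_trans t0 ts.
have near_sE z : `|rho z s - rb| <= e / (4 * M).
  by rewrite leNgt; apply/negP => hz; apply: near_s; exists z.
have avg_s := kernel_average h0 (fun z => (kb x h z h0).1) (fun z => crho z s s0)
  (fun z _ => near_sE z).
have avg_t := @kernel_average _ (rho^~ t) M h x (rho x t) (e / (4 * M)) h0
  (fun z => (kb x h z h0).1) (fun z => crho z t t0).
have {}avg_t : `|\int[lam]_z (rho z t * kernel x h z) - rho x t| <= e / (4 * M) * M.
  by apply: avg_t => z xz; rewrite distrC; exact: osc.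
have := lip x t s t0 ts.
have eM : e / (4 * M) * M = e / 4 by field; rewrite gt_eqF.
rewrite eM in avg_s avg_t.
have Kst : K * (s - t) <= e / 4.
  have -> : e / 4 = K * (e / (4 * K)) by field; rewrite gt_eqF.
  by rewrite ler_pM2l//; lra.
move=> d; have {Kst}d := le_trans d Kst.
suff : `|rho x t - rb| <= e by rewrite leNgt far.
move: avg_s avg_t d; set I := \int[lam]_z (rho z s * kernel x h z).
set J := \int[lam]_z (rho z t * kernel x h z).
rewrite !ler_norml => /andP[? ?] /andP[? ?] /andP[? ?].
by apply/andP; split; lra.
Qed.

(** Bad times occur arbitrarily late, so each new interval can start after the set already built and
    is disjoint from it. Null sets are removed so that [P] holds at every point of [E]. *)
Lemma recurrent_set (tau : R) (bad : R -> Prop) (P : R -> Prop) : 0 < tau ->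
  (forall T, exists2 t, T <= t & bad t) ->
  (forall t, 0 < t -> bad t -> {ae lam, forall s, t < s < t + tau -> P s}) ->
  forall n : nat, exists T (E : set R), [/\ 0 < T,
    @measurable _ (measurableTypeR R) E, E `<=` `]0, T[%classic,
    ((n%:R * tau)%:E <= lam E)%E & forall s, E s -> P s].
Proof.
move=> tau0 recur persist; elim=> [|n [T [E [T0 mE ET lamE EP]]]].
  by exists 1, set0; split => //; rewrite mul0r measure0.
have [t Tt badt] := recur T.
have t0 : 0 < t := lt_le_trans T0 Tt.
have [N [mN N0 subN]] := persist t t0 badt.
set I := `]t, t + tau[%classic.
have mI : @measurable _ (measurableTypeR R) I by exact: measurable_itv.
have mIN : @measurable _ (measurableTypeR R) (I `\` N) by exact: measurableD.
have lamI : (tau%:E <= lam (I `\` N))%E.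
  have II : I `<=` (I `\` N) `|` N.
    by move=> s Is; have [Ns|Ns] := pselect (N s); [right|left].
  have lamIE : (lam I = tau%:E)%E.
    by rewrite /I lebesgue_measure_itv/= lte_fin ltrDl tau0 -EFinD addrC addKr.
  have le1 : (lam I <= lam ((I `\` N) `|` N))%E.
    by apply: (@le_measure _ _ (measurableTypeR R) lam) => //;
      rewrite inE//; exact: measurableU.
  have le2 : (lam ((I `\` N) `|` N) <= lam (I `\` N) + lam N)%E.
    exact: (measureU2 lam mIN mN).
  by move: (le_trans le1 le2); rewrite lamIE N0 adde0.
have disj : E `&` (I `\` N) = set0.
  rewrite -subset0 => s [/ET/=]; rewrite in_itv/= => /andP[_ sT] [].
  rewrite /I/= in_itv/= => /andP[ts _] _.
  by have := lt_trans sT (le_lt_trans Tt ts); rewrite ltxx.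
exists (t + tau), (E `|` (I `\` N)); split.
- exact: addr_gt0.
- exact: measurableU.
- move=> s [/ET/=|[]]; rewrite /I/= !in_itv/= => /andP[s1 s2].
    by apply/andP; split; lra.
  by move=> _; apply/andP; split; lra.
- have -> : lam (E `|` (I `\` N)) = (lam E + lam (I `\` N))%E.
    exact: (measureU lam mE mIN disj).
  have -> : n.+1%:R * tau = n%:R * tau + tau by rewrite -natr1 mulrDl mul1r.
  by rewrite EFinD leeD.
- move=> s [/EP//|[Is nN]]; apply: contrapT => nP; apply: nN; apply: subN => /=.
  by apply/not_implyP; split => //; move: Is; rewrite /I/= in_itv.
Qed.

Lemma sup_norm_cvg0 (f : R -> R -> R) :
  (forall e, 0 < e -> exists T, forall t, T <= t -> forall x, `|f x t| <= e) ->
  sup (range (fun x => `|f x t|)) @[t --> +oo] --> 0.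
Proof.
move=> unif; apply/cvgr0Pnorm_le => e e0; have [T HT] := unif e e0.
near=> t.
have Tt : T <= t by near: t; apply: nbhs_pinfty_ge; exact: num_real.
rewrite ger0_norm.
  apply: ge_sup; first by exists `|f 0 t|, 0.
  by move=> _ [x _ <-]; exact: HT.
(* The uniform bound makes the range bounded above, so [sup] dominates its elements. *)
apply: (@le_trans _ _ `|f 0 t|) => //; apply: ub_le_sup; last by exists 0.
by exists e => _ [x _ <-]; exact: HT.
Unshelve. all: by end_near. Qed.

End LongTime.

Theorem theorem2p3 (R : realType) (gamma alpha rb C : R)
    (m0 : R -> R) (rho u Dr Gr : R -> R -> R) :
  1 < gamma -> 0 < alpha -> 0 <= rb ->
  (alpha <= 2^-1 \/ 0 < rb) ->
  (* m0 is locally integrable (initial momentum) *)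
  (forall a b : R, (@lebesgue_measure R).-integrable `[a, b]
                      (fun x => (m0 x)%:E)) ->
  global_weak_solution gamma alpha rb m0 rho u Dr ->
  (* conclusions of Theorem 2.1 / 2.2, with C independent of T *)
  {within [set z : R * R | 0 <= z.2], continuous (fun z => rho z.1 z.2)} ->
  (forall x t, 0 <= t -> rho x t <= C) ->
  (0 < rb -> forall t, 0 <= t ->
     (\int[@lebesgue_measure R]_x ((rho x t - rb) ^+ 2)%:E <= C%:E)%E) ->
  (rb = 0 -> forall t, 0 <= t ->
     (\int[@lebesgue_measure R]_x (rho x t)%:E <= C%:E)%E) ->
  (* Gr is the weak x-derivative of rho^((gamma+alpha-1)/2), for a.e. t > 0 *)
  {ae @lebesgue_measure R, forall t, 0 < t ->
     weak_deriv (fun x => epow ((gamma + alpha - 1) / 2) (rho x t))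
                (fun x => Gr x t)} ->
  (forall T, 0 < T ->
     {ae @lebesgue_measure R, forall t, 0 < t < T ->
       (\int[@lebesgue_measure R]_x
           ((Num.sqrt (rho x t) * u x t) ^+ 2 + Dr x t ^+ 2
             + rhoPsi gamma rb (rho x t))%:E
        + \int[@lebesgue_measure R]_(t' in `]0%R, T[)
            \int[@lebesgue_measure R]_x ((Gr x t') ^+ 2)%:E
        <= C%:E)%E}) ->
  sup (range (fun x => `|rho x t - rb|)) @[t --> +oo] --> 0.
Proof.
move=> g1 a0 rb0 _ _ sol crho0 rhoC L2pos L1zero aeG energy.
have rho0 x t : 0 <= rho x t by have [+ _] := sol 1 ltr01.
have rhoC' x t : 0 < t -> 0 <= rho x t <= C by move=> t0; rewrite rho0 rhoC// ltW.
have crho := continuous_positive_times crho0.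
have mv : jointly_measurable (fun x t => Num.sqrt (rho x t) * u x t).
  by case: (sol 1 ltr01) => _ [_ [_ [[]]]].
pose en t x := (Num.sqrt (rho x t) * u x t) ^+ 2 + Dr x t ^+ 2 + rhoPsi gamma rb (rho x t).
(* Nonnegativity of the potential energy allows the kinetic and derivative terms to be bounded
   separately by the total. *)
have psi0 x t : 0 <= rhoPsi gamma rb (rho x t) by exact: rhoPsi_ge0.
have en0 t x : 0 <= en t x by rewrite !addr_ge0 ?sqr_ge0.
pose diss t := (\int[@lebesgue_measure R]_x ((Gr x t) ^+ 2)%:E)%E.
have diss0 t : (0 <= diss t)%E by apply: integral_ge0 => x _; rewrite lee_fin sqr_ge0.
have total_diss T : 0 < T ->
    (\int[@lebesgue_measure R]_(t in `]0%R, T[) diss t <= C%:E)%E.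
  (* The dissipation up to [T] does not depend on [t], so a single admissible [t] bounds it. *)
  move=> T0; have [t [_ le_C]] := ae_dense (energy T T0) T0.
  apply: le_trans le_C; rewrite leeDr//; apply: integral_ge0 => x _.
  by rewrite lee_fin; exact: en0.
have energyC : {ae @lebesgue_measure R, forall t, 0 < t ->
    (\int[@lebesgue_measure R]_x (en t x)%:E <= C%:E)%E}.
  apply: ae_pos => T T0; apply: ae_imply (energy T T0) => t le_C tT.
  apply: le_trans (le_C tT); rewrite leeDl//.
  by apply: integral_ge0 => s _; exact: diss0.
have kineticC : {ae @lebesgue_measure R, forall t, 0 < t ->
    (\int[@lebesgue_measure R]_x ((Num.sqrt (rho x t) * u x t) ^+ 2)%:E <= C%:E)%E}.
  apply: ae_imply energyC => t le_C t0; apply: le_trans (le_C t0).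
  apply: le_integral_nonmeasurable => x _; rewrite lee_fin ?sqr_ge0//.
  by rewrite /en -addrA lerDl addr_ge0 ?sqr_ge0.
have wD : {ae @lebesgue_measure R, forall t, 0 < t ->
    weak_deriv (fun x => Dfun alpha (rho x t)) (Dr^~ t)}.
  by apply: ae_pos => T T0; case: (sol T T0) => _ [_ [_ [_ [_ []]]]].
have aeD : {ae @lebesgue_measure R, forall t, 0 < t ->
    weak_deriv (fun x => Dfun alpha (rho x t)) (Dr^~ t) /\
    (\int[@lebesgue_measure R]_x (Dr x t ^+ 2)%:E <= C%:E)%E}.
  apply: ae_imply2 wD energyC => t wt le_C t0; split; first exact: wt.
  apply: le_trans (le_C t0).
  apply: le_integral_nonmeasurable => x _; rewrite lee_fin ?sqr_ge0//.
  by rewrite /en -addrA addrCA lerDl addr_ge0 ?sqr_ge0.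
have mass h : 0 < h -> exists2 K, 0 < K & forall x t1 t2, 0 < t1 -> t1 <= t2 ->
    `|\int[@lebesgue_measure R]_z (rho z t2 * kernel x h z)
      - \int[@lebesgue_measure R]_z (rho z t1 * kernel x h z)| <= K * (t2 - t1).
  move=> h0; apply: (mass_average_lipschitz h0 rho0 rhoC mv kineticC).
  move=> zeta t1 t2 Cz Kz t10 t12.
  (* The horizon [t2 + 1] is positive and lies beyond [t2], as the weak formulation on a bounded
     time interval requires. *)
  have T0 : 0 < t2 + 1 by rewrite ltr_wpDl// (le_trans t10).
  case: (sol _ T0) => _ [_ [_ [_ [_ [_ _ mass_eq _]]]]].
  by apply: mass_eq => //; rewrite lerDl.
have equi e (e0 : 0 < e) := equicontinuous_all_times crho rhoC' aeD e0.
apply: (@sup_norm_cvg0 _ (fun x t => rho x t - rb)) => e e0; apply: contrapT => never.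
have [e' e'0 [tau tau0 persist]] :=
  deviation_persists rb (fun x t t0 => (crho x t t0).1) equi mass e0.
have beta0 : 0 < (gamma + alpha - 1) / 2 by rewrite divr_gt0//; lra.
have [c c0 lower] := dissipation_lower_bound C beta0 rb0 e'0.
pose bad t := exists x, e < `|rho x t - rb|.
have recur T : exists2 t, T <= t & bad t.
  apply: contrapT => nbad; apply: never; exists T => t Tt x.
  by rewrite leNgt; apply/negP => far; apply: nbad; exists t => //; exists x.
have bad_diss t : 0 < t -> bad t ->
    {ae @lebesgue_measure R, forall s, t < s < t + tau -> (c%:E <= diss s)%E}.
  move=> t0 [x far]; apply: ae_imply aeG => s wG /andP[ts st].
  have s0 : 0 < s := lt_trans t0 ts.
  apply: (lower (rho^~ s) (Gr^~ s)).
  - by move=> z; exact: (crho z s s0).1.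
  - by move=> z; exact: rhoC'.
  - by move=> rbp; exact: L2pos rbp s (ltW s0).
  - by move=> rbz; exact: L1zero rbz s (ltW s0).
  - exact: wG.
  - exact: persist x t t0 far s (ltW ts) (ltW st).
(* Enough intervals of length [tau], each with dissipation rate at least [c], to exceed the total
   budget [C]. *)
pose n := (Num.truncn (`|C| / (tau * c))).+1.
have [T [E [T0 mE ET lamE Ec]]] := recurrent_set tau0 recur bad_diss n.
have nC : C < c * (n%:R * tau).
  apply: le_lt_trans (ler_norm C) _.
  have -> : c * (n%:R * tau) = n%:R * (tau * c) by ring.
  rewrite -ltr_pdivrMr ?mulr_gt0//; exact: truncnS_gt.
have lb : (c%:E * @lebesgue_measure R E <=
    \int[@lebesgue_measure R]_(t in `]0%R, T[) diss t)%E.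
  exact: (@cst_le_integral _ _ (measurableTypeR R) (@lebesgue_measure R) `]0, T[%classic E
    diss c mE ET (ltW c0) (fun s _ => diss0 s) Ec).
have : (c%:E * (n%:R * tau)%:E <= C%:E)%E.
  apply: le_trans (le_trans lb (total_diss T T0)).
  by rewrite lee_pmul2l.
by rewrite -EFinM lee_fin leNgt nC.
Qed.
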